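(* There exists $\delta_0>0$ such that for every $\delta\in(0,\delta_0)$ there is $C_0$ such that for every $C\ge C_0$ there is $\delta'_0>0$ such that for every $\delta'\in(0,\delta'_0)$ there is $K_0$ such that for every $K\ge K_0$ the following holds for all $n\in\mathbb{N}$ and $r\in[n]$. Let $H$ be a random graph sampled from a $Cr/n$-spread distribution on $r$-regular $(\delta,\delta',r/n)$-dense subgraphs of $K_{n,n}$. Then there is an event $G$ determined by $H$ with $\mathbb{P}(G)>1-n^{-8}$ and a random $1$-factorisation $(H_1,\dots,H_r)$ of $H$ defined on $G$ such that for all $S_1,\dots,S_r\subset E(K_{n,n})$, $$\mathbb{P}\Big(\bigcap_c\{S_c\subset H_c\}\ \Big|\ G\Big)\le (K/n)^{\sum_c|S_c|}.$$
   Context: $K_{n,n}$ has parts $U_1,U_2$ of size $n$. A random subgraph $H$ of a graph $F$ is (has a distribution that is) $q$-spread if $\mathbb{P}(S\subset H)\le q^{|S|}$ for every $S\subset E(F)$. A bipartite graph $H$ on $(U_1,U_2)$ is $(\delta,\delta',p)$-dense if for all $V_1\subset U_1,V_2\subset U_2$ with $|V_1|,|V_2|\ge\delta' n$ the number of edges of $H$ between $V_1$ and $V_2$ is at least $(1-\delta)p|V_1||V_2|$. A $1$-factorisation of $H$ is a partition of $E(H)$ into perfect matchings $H_1,\dots,H_r$. *)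

(* Defs.v *)
From HB Require Import structures.
From mathcomp Require Import all_boot all_order all_algebra.
From mathcomp Require Import reals.
Set Implicit Arguments. Unset Strict Implicit. Unset Printing Implicit Defensive.
Import Order.TTheory GRing.Theory Num.Theory.
Local Open Scope ring_scope.

(* K_{n,n}: parts U1 = 'I_n, U2 = 'I_n; edge (u,v) joins u in U1 to v in U2.
   A subgraph is identified with its edge set. *)
Definition edge (n : nat) : finType := ('I_n * 'I_n)%type.

Definition regular_bip (n r : nat) (H : {set edge n}) : Prop :=
  (forall u : 'I_n, #|[set v : 'I_n | (u, v) \in H]| = r) /\
  (forall v : 'I_n, #|[set u : 'I_n | (u, v) \in H]| = r).

Definition dense_bip {R : realType} (n : nat) (delta delta' p : R)
    (H : {set edge n}) : Prop :=
  forall V1 V2 : {set 'I_n},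
    delta' * n%:R <= #|V1|%:R -> delta' * n%:R <= #|V2|%:R ->
    (1 - delta) * p * #|V1|%:R * #|V2|%:R <=
      #|[set e in H | (e.1 \in V1) && (e.2 \in V2)]|%:R.

Definition perfect_matching (n : nat) (M : {set edge n}) : Prop :=
  (forall u : 'I_n, #|[set v : 'I_n | (u, v) \in M]| = 1%N) /\
  (forall v : 'I_n, #|[set u : 'I_n | (u, v) \in M]| = 1%N).

Definition one_factorisation (n r : nat) (H : {set edge n})
    (F : {ffun 'I_r -> {set edge n}}) : Prop :=
  (forall c, perfect_matching (F c)) /\
  (forall c c', c != c' -> [disjoint F c & F c']) /\
  \bigcup_(c < r) F c = H.

Definition is_distr {R : realType} (T : finType) (mu : T -> R) : Prop :=
  (forall x, 0 <= mu x) /\ \sum_(x : T) mu x = 1.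

Definition spread {R : realType} (n : nat) (mu : {set edge n} -> R) (q : R)
  : Prop :=
  forall S : {set edge n}, \sum_(H : {set edge n} | S \subset H) mu H <= q ^+ #|S|.

(* Main.v *)
Require Import Defs.
From HB Require Import structures.
From mathcomp Require Import all_boot all_order all_algebra.
From mathcomp Require Import reals boolp sequences exp.
From mathcomp Require Import lra ring zify.
Import Order.TTheory GRing.Theory Num.Theory.
Local Open Scope ring_scope.
Set Implicit Arguments. Unset Strict Implicit. Unset Printing Implicit Defensive.

(* An r-regular graph is split into two halves, again and again. Call H
   expanding if every set T of at most n vertices has at least a r |T| boundary
   edges, for a constant a. Colour every edge of H independently "first half",
   "second half" or, with the small probability eta ~ 1/k^2 where r ~ 2^k,
   "reserve". The local lemma, applied to all connected vertex sets, allows one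
   to condition on all boundaries being divided evenly; this changes the
   probability of an event on s edges by at most a factor (1 + 1/r)^s. By
   expansion the reserve then satisfies the cut condition, so it contains a
   correction making both halves exactly regular, and the correction may be
   chosen arbitrarily, since an edge lies in the reserve with probability eta
   only: it costs a factor 1 + O(eta) per edge. Expansion is inherited up to a
   factor 1 - 1/k^2. As the sum of 1/k^2 converges, the halving can be iterated
   down to bounded degree, where any 1-factorisation will do; this gives an
   O(1/r)-spread 1-factorisation of every expanding H. A random H from the given
   distribution expands with high probability: large sets by density, small sets
   by spreadness and a union bound. The two spreads multiply to
   O(1/r) (C r / n) = O(1/n). *)

(** * Product measures and the local lemma *)

Section ProductMeasure.
Variables (R : realType) (E C : finType) (w : C -> R).
Hypothesis w_ge0 : forall c, 0 <= w c.
Hypothesis w_sum1 : \sum_c w c = 1.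
Implicit Types (f g : {ffun E -> C}) (A B : {set {ffun E -> C}}) (D : {set E}).

Definition weight f : R := \prod_e w (f e).
Definition Pr A : R := \sum_(f in A) weight f.

Definition determined D A :=
  forall f g, {in D, f =1 g} -> (f \in A) = (g \in A).

Lemma weight_ge0 f : 0 <= weight f.
Proof. exact: prodr_ge0. Qed.

Lemma Pr_ge0 A : 0 <= Pr A.
Proof. by apply: sumr_ge0 => f _; exact: weight_ge0. Qed.

Lemma Pr_prod (h : E -> C -> R) :
  \sum_f weight f * (\prod_e h e (f e)) = \prod_e \sum_c w c * h e c.
Proof.
rewrite bigA_distr_bigA; apply: eq_bigr => f _.
by rewrite -big_split.
Qed.

Lemma PrT : Pr setT = 1.
Proof.
transitivity (\sum_f weight f); first by apply: eq_bigl => f; rewrite inE.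
by rewrite -(bigA_distr_bigA (fun=> w)) big1.
Qed.

Lemma PrS A B : A \subset B -> Pr A <= Pr B.
Proof.
move=> sAB; rewrite /Pr [leRHS](big_setID A) /= (setIidPr sAB) lerDl.
by apply: sumr_ge0 => f _; exact: weight_ge0.
Qed.

Lemma PrID A B : Pr A = Pr (A :&: B) + Pr (A :\: B).
Proof. exact: big_setID. Qed.

Lemma PrU A B : Pr (A :|: B) <= Pr A + Pr B.
Proof.
rewrite (PrID (A :|: B) A) (setIidPr (subsetUl A B)) lerD2l PrS //.
by apply/subsetP => f; rewrite !inE; case: (f \in A).
Qed.

(* Exchanging the coordinates outside D of two independent samples is a
   measure preserving involution. *)
Lemma Pr_indep D A B : determined D A -> determined (~: D) B ->
  Pr (A :&: B) = Pr A * Pr B.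
Proof.
move=> dA dB.
pose mix (f g : {ffun E -> C}) : {ffun E -> C} :=
  [ffun e => if e \in D then f e else g e].
pose sw (p : {ffun E -> C} * {ffun E -> C}) := (mix p.1 p.2, mix p.2 p.1).
have swK : involutive sw.
  case=> f g; rewrite /sw /=; congr pair; apply/ffunP => e;
    by rewrite !ffunE; case: (e \in D).
have wsw f g : weight (mix f g) * weight (mix g f) = weight f * weight g.
  rewrite /weight -!big_split /=; apply: eq_bigr => e _; rewrite !ffunE.
  by case: (e \in D) => //; rewrite mulrC.
have pairE (a b : {ffun E -> C} -> bool) :
    (\sum_(f | a f) weight f) * (\sum_(g | b g) weight g) =
    \sum_(p : {ffun E -> C} * {ffun E -> C} | a p.1 && b p.2)
       weight p.1 * weight p.2.
  by rewrite big_distrlr /= pair_big.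
rewrite -[LHS]mulr1 -PrT /Pr !pairE (reindex_inj (inv_inj swK)) /=.
under eq_bigr => p _ do rewrite wsw.
apply: eq_bigl => -[f g]; rewrite /= !inE andbT; congr andb.
  by apply: dA => e eD; rewrite ffunE eD.
by apply: dB => e; rewrite inE ffunE => /negPf ->.
Qed.

End ProductMeasure.

Section LocalLemma.
Variables (R : realType) (E C : finType) (w : C -> R).
Hypothesis w_ge0 : forall c, 0 <= w c.
Hypothesis w_sum1 : \sum_c w c = 1.
Variables (I : finType) (B : I -> {set {ffun E -> C}}) (D : I -> {set E}).
Variable (x : I -> R).
Hypothesis x_ge0 : forall i, 0 <= x i.
Hypothesis x_lt1 : forall i, x i < 1.
Hypothesis B_det : forall i, determined (D i) (B i).
(** The asymmetric Lovász condition, with dependence read off from shared coordinates. *)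
Hypothesis B_small : forall i,
  Pr w (B i) <= x i * \prod_(j | D i :&: D j != set0) (1 - x j).
Implicit Types (J K : {set I}).

Let P : {set {ffun E -> C}} -> R := Pr w.
Definition avoid J : {set {ffun E -> C}} := \bigcap_(j in J) ~: B j.

Lemma avoidP J f : reflect (forall j, j \in J -> f \notin B j) (f \in avoid J).
Proof.
by apply: (iffP bigcapP) => h j /h; rewrite inE.
Qed.

Lemma determined_avoid J (S : {set E}) :
  (forall j, j \in J -> [disjoint S & D j]) -> determined (~: S) (avoid J).
Proof.
move=> dis f g efg; apply/avoidP/avoidP => h j jJ.
  rewrite -(B_det (f := f)) ?h // => e eD; apply: efg; rewrite inE.
  by apply: contraL eD => eS; rewrite (disjointFr (dis _ jJ)).
rewrite (B_det (g := g)) ?h // => e eD; apply: efg; rewrite inE.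
by apply: contraL eD => eS; rewrite (disjointFr (dis _ jJ)).
Qed.

Let x_le1 j : 1 - x j <= 1. Proof. by rewrite gerBl. Qed.
Let x_ge01 j : 0 <= 1 - x j. Proof. by rewrite subr_ge0 ltW. Qed.

(** Chain rule: the events of [J] join the avoided family one at a time, each at the cost of a
    factor [1 - x j]. *)
Lemma avoid_chain J K :
  (forall i (L : {set I}), L \proper J :|: K -> P (B i :&: avoid L) <= x i * P (avoid L)) ->
  P (avoid (J :|: K)) >= (\prod_(j in J) (1 - x j)) * P (avoid K).
Proof.
have [m] := ubnP #|J|; elim: m J => // m IHm J0 leJ0 h0.
have [E0|[j jJ0]] := set_0Vmem J0; first by rewrite E0 set0U big_set0 mul1r.
move: leJ0 h0; rewrite -(setD1K jJ0); set J := J0 :\ j.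
have jJ : j \notin J by rewrite !inE eqxx.
rewrite cardsU1 jJ => /IHm IH h.
have [jK|jK] := boolP (j \in J :|: K).
  rewrite -setUA (setUidPr _) ?sub1set // in h *.
  apply: le_trans (IH h); rewrite big_setU1 //= -mulrA ler_piMl //.
  apply: mulr_ge0; first by apply: prodr_ge0 => i _.
  exact: Pr_ge0.
have prop : J :|: K \proper j |: J :|: K.
  rewrite -setUA properE subsetUr /= subUset sub1set negb_and jK //.
rewrite big_setU1 //= -setUA -mulrA.
have IH' : (\prod_(j in J) (1 - x j)) * P (avoid K) <= P (avoid (J :|: K)).
  apply: IH => i L LJ; apply: h; exact: proper_trans LJ prop.
apply: le_trans (ler_wpM2l (x_ge01 j) IH') _.
have -> : avoid (j |: (J :|: K)) = avoid (J :|: K) :\: B j.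
  by rewrite /avoid big_setU1 //= setIC -setDE.
rewrite mulrBl mul1r lerBlDr {1}/P (PrID _ _ (B j)) addrC lerD2l.
by rewrite setIC; exact: h.
Qed.

Definition nbr (S : {set E}) : {set I} := [set j | S :&: D j != set0].

(** [A] is independent of avoiding the events that share no coordinate with [S], and [avoid_chain]
    puts the neighbours of [S] back. With [S = D i] this drives the induction; with [J = setT] it
    becomes the bound for the conditioned measure. *)
Lemma local_lemma_split (S : {set E}) A J : determined S A ->
  (forall i (L : {set I}), L \proper J -> P (B i :&: avoid L) <= x i * P (avoid L)) ->
  (\prod_(j in nbr S) (1 - x j)) * P (A :&: avoid J) <= P A * P (avoid J).
Proof.
move=> dA h; set J2 := J :\: nbr S; set J1 := J :&: nbr S.
have JE : J = J1 :|: J2 by rewrite setID.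
have h1 : P (A :&: avoid J) <= P A * P (avoid J2).
  have dJ2 : determined (~: S) (avoid J2).
    apply: determined_avoid => j; rewrite !inE negbK => /andP[/eqP d _].
    by rewrite -setI_eq0 d.
  rewrite -(Pr_indep w_sum1 dA dJ2) PrS //; apply: setIS.
  apply/subsetP => f /avoidP fJ; apply/avoidP => j; rewrite inE => /andP[_].
  exact: fJ.
have h2 : (\prod_(j in J1) (1 - x j)) * P (avoid J2) <= P (avoid J).
  rewrite [in P (avoid J)]JE; apply: avoid_chain => i L; rewrite -JE; exact: h.
have le12 : \prod_(j in nbr S) (1 - x j) <= \prod_(j in J1) (1 - x j).
  rewrite (big_setID J) /= setIC -/J1 ler_piMr //.
    exact: prodr_ge0.
  by apply: prodr_ile1 => j _; rewrite x_ge01 x_le1.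
apply: le_trans (ler_wpM2r (Pr_ge0 w_ge0 _) le12) _.
have pp : 0 <= \prod_(j in J1) (1 - x j) by exact: prodr_ge0.
apply: le_trans (ler_wpM2l pp h1) _.
by rewrite mulrCA ler_wpM2l // Pr_ge0.
Qed.

Lemma local_lemma_step J i : P (B i :&: avoid J) <= x i * P (avoid J).
Proof.
have [m] := ubnP #|J|; elim: m J i => // m IH J i leJ.
have h (L : {set I}) : L \proper J -> forall i, P (B i :&: avoid L) <= x i * P (avoid L).
  by move=> /proper_card LJ i'; apply: IH; apply: leq_trans LJ _.
have := local_lemma_split (@B_det i) (fun i' (L : {set I}) (LJ : L \proper J) => h L LJ i').
have -> : \prod_(j in nbr (D i)) (1 - x j) = \prod_(j | D i :&: D j != set0) (1 - x j).
  by apply: eq_bigl => j; rewrite inE.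
set q := \prod_(_ | _) _ => le1.
have q0 : 0 < q by apply: prodr_gt0 => j _; rewrite subr_gt0.
rewrite -(ler_pM2l q0); apply: le_trans le1 _.
rewrite mulrA [q * _]mulrC; apply: ler_wpM2r; first exact: Pr_ge0.
exact: B_small.
Qed.

Lemma local_lemma_gt0 : 0 < P (avoid setT).
Proof.
have := @avoid_chain setT set0 (fun i L _ => local_lemma_step L i).
rewrite setU0 => /(lt_le_trans _); apply.
rewrite mulr_gt0 //.
  by apply: prodr_gt0 => j _; rewrite subr_gt0.
by rewrite /avoid big_set0 /P PrT.
Qed.

Lemma local_lemma (S : {set E}) A : determined S A ->
  (\prod_(j in nbr S) (1 - x j)) * P (A :&: avoid setT) <=
  P A * P (avoid setT).
Proof.
by move=> dA; apply: local_lemma_split => // i L _; exact: local_lemma_step.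
Qed.

End LocalLemma.

(** * Exponential tail bound and product inequalities *)

Lemma expR_le_quad (R : realType) (x : R) : `|x| <= 2^-1 ->
  expR x <= 1 + x + 2 * x ^+ 2.
Proof.
rewrite ler_norml => /andP[x1 x2].
(* [expR x] is at most [1 / (1 - x)], and [(1 + x + 2 x^2) (1 - x) = 1 + x^2 (1 - 2 x)]. *)
have e0 := expR_gt0 (- x); have e1 := expR_ge1Dx (- x).
rewrite -[x in expR x]opprK expRN invf_ple ?posrE //; last by nra.
apply: le_trans e1; rewrite invf_ple ?posrE; [|nra|lra].
by rewrite -div1r ler_pdivrMr; [nra|lra].
Qed.

Lemma chernoff (R : realType) (E C : finType) (w : C -> R) (D : {set E})
    (y : E -> C -> R) (b : R) :
  (forall c, 0 <= w c) -> \sum_c w c = 1 -> 0 <= b <= 1 ->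
  (forall e c, `|y e c| <= 2) ->
  (forall e, e \in D -> \sum_c w c * y e c <= - b) ->
  Pr w [set f : {ffun E -> C} | 0 <= \sum_(e in D) y e (f e)] <=
    expR (- (b ^+ 2 / 32) * #|D|%:R).
Proof.
move=> w_ge0 w_sum1 /andP[b0 b1] y2 yb.
(* This minimises [- h b + 8 h^2], the exponent available for one coordinate; the minimum is
   [- b^2 / 32]. *)
pose h := b / 16.
have step : \sum_f weight w f *
    (\prod_e (if e \in D then expR (h * y e (f e)) else 1)) <=
    expR (- (b ^+ 2 / 32) * #|D|%:R).
  rewrite (Pr_prod w (fun e c => if e \in D then expR (h * y e c) else 1)).
  rewrite expRM_natr -prodr_const [leRHS]big_mkcond /=; apply: ler_prod => e _.
  apply/andP; split.
    apply: sumr_ge0 => c _; apply: mulr_ge0 => //.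
    by case: ifP => _ //; exact: expR_ge0.
  have [eD|_] := boolP (e \in D); last by under eq_bigr do rewrite mulr1; rewrite w_sum1.
  apply: (@le_trans _ _ (\sum_c w c * (1 + h * y e c + 8 * h ^+ 2))).
    apply: ler_sum => c _; apply: ler_wpM2l => //.
    have := y2 e c; rewrite ler_norml => /andP[ya yc].
    apply: le_trans (expR_le_quad _) _.
      by rewrite ler_norml /h; apply/andP; split; nra.
    rewrite lerD2l exprMn.
    have : y e c ^+ 2 <= 4 by nra.
    have : 0 <= h ^+ 2 by rewrite sqr_ge0.
    nra.
  apply: (@le_trans _ _ (1 + - (b ^+ 2 / 32))); last exact: expR_ge1Dx.
  have -> : \sum_c w c * (1 + h * y e c + 8 * h ^+ 2) =
      \sum_c w c * (1 + 8 * h ^+ 2) + h * \sum_c w c * y e c.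
    rewrite big_distrr /= -big_split /=; apply: eq_bigr => c _; ring.
  rewrite -big_distrl /= w_sum1 /h.
  have := yb e eD; set s := \sum_c _ => sb.
  nra.
apply: le_trans step; rewrite /Pr big_mkcond /=; apply: ler_sum => f _.
have pr0 : 0 <= \prod_e (if e \in D then expR (h * y e (f e)) else 1).
  by apply: prodr_ge0 => e _; case: ifP => _ //; exact: expR_ge0.
have wf0 := weight_ge0 w_ge0 f.
rewrite inE; case: ifP => [s0|_]; last exact: mulr_ge0.
rewrite ler_peMr // -big_mkcond /= -expR_sum -(expR0 R) ler_expR.
rewrite -big_distrr /= mulr_ge0 // /h; lra.
Qed.

Lemma prod1B_ge (R : realDomainType) (I : finType) (P : pred I) (x : I -> R) :
  (forall i, 0 <= x i <= 1) ->
  1 - \sum_(i | P i) x i <= \prod_(i | P i) (1 - x i).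
Proof.
move=> x01.
suff [] : 0 <= \prod_(i | P i) (1 - x i) <= 1 /\
    1 - \sum_(i | P i) x i <= \prod_(i | P i) (1 - x i) by [].
elim/big_rec2: _ => [|i s p Pi [/andP[p0 p1] ps]]; first by rewrite subr0 ler01 lexx.
have /andP[a b] := x01 i.
split; last by nra.
by apply/andP; split; nra.
Qed.

(** Multiplying over the vertices [v] of [U] and then over the sets through [v] counts every set
    meeting [U] at least once, with factors at most 1. Each inner product is at least [1 - s]. *)
Lemma prod_meet_ge (R : realDomainType) (V : finType) (x : {set V} -> R)
    (s : R) (U : {set V}) :
  (forall T, 0 <= x T <= 1) -> s <= 1 ->
  (forall v, \sum_(T : {set V} | v \in T) x T <= s) ->
  (1 - s) ^+ #|U| <= \prod_(T : {set V} | T :&: U != set0) (1 - x T).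
Proof.
move=> x01 s1 hs; rewrite -prodr_const.
have x01' T : 0 <= 1 - x T <= 1 by have /andP[? ?] := x01 T; apply/andP; split; lra.
apply: (@le_trans _ _ (\prod_(v in U) \prod_(T : {set V} | v \in T) (1 - x T))).
  apply: ler_prod => v _; rewrite subr_ge0 s1 /=.
  by apply: le_trans (prod1B_ge _ x01); rewrite lerD2l lerN2.
under eq_bigr => v _ do rewrite big_mkcond.
rewrite exchange_big /= [leRHS]big_mkcond /=; apply: ler_prod => T _.
have f01 v : 0 <= (if v \in T then 1 - x T else 1) <= 1.
  by case: ifP => _; rewrite ?x01' // ler01 lexx.
rewrite prodr_ge0 => [|v _]; last by have /andP[] := f01 v.
case: ifP => [/set0Pn[v]|_]; last exact: prodr_ile1.
rewrite inE => /andP[vT vU]; rewrite (bigD1 v) //= vT ler_piMr //.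
  by have /andP[] := x01' T.
exact: prodr_ile1.
Qed.

(** * Regular subgraphs between two bounds *)

Section Sandwich.
Variable n : nat.
Local Open Scope nat_scope.
Implicit Types (A B M : {set edge n}) (X Z : {set 'I_n}) (x z u v : 'I_n).

Definition degL M x := \sum_z ((x, z) \in M).
Definition degR M z := \sum_x ((x, z) \in M).
Definition nb_edges M X Z := \sum_(x in X) \sum_(z in Z) ((x, z) \in M).

Lemma degL_card M x : #|[set z | (x, z) \in M]| = degL M x.
Proof.
by rewrite -sum1_card /degL [RHS]big_mkcond /= big_mkcond; apply: eq_bigr => z _;
  rewrite inE; case: (_ \in _).
Qed.

Lemma degR_card M z : #|[set x | (x, z) \in M]| = degR M z.
Proof.
by rewrite -sum1_card /degR [RHS]big_mkcond /= big_mkcond; apply: eq_bigr => x _;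
  rewrite inE; case: (_ \in _).
Qed.

Lemma regular_bipP r M :
  regular_bip r M <-> (forall x, degL M x = r) /\ (forall z, degR M z = r).
Proof.
split=> -[hL hR]; split=> a.
- by rewrite -degL_card hL.
- by rewrite -degR_card hR.
- by rewrite degL_card hL.
- by rewrite degR_card hR.
Qed.

Lemma nb_edges_card M X Z : nb_edges M X Z = #|[set e in M | (e.1 \in X) && (e.2 \in Z)]|.
Proof.
rewrite /nb_edges pair_big /= -sum1_card [LHS]big_mkcond [RHS]big_mkcond /=.
apply: eq_bigr => -[x z] _; rewrite !inE /=.
by case: (_ \in M); rewrite ?andbF //=; case: ifP.
Qed.

Lemma sum_degL M X Z : \sum_(x in X) degL M x = nb_edges M X Z + nb_edges M X (~: Z).
Proof.
rewrite /nb_edges -big_split /=; apply: eq_bigr => x _.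
rewrite /degL (bigID (mem Z)) /=; congr addn.
by apply: eq_bigl => z; rewrite inE.
Qed.

Lemma sum_degR M X Z : \sum_(z in Z) degR M z = nb_edges M X Z + nb_edges M (~: X) Z.
Proof.
rewrite /nb_edges /degR exchange_big (bigID (mem X)) /=; congr addn.
by apply: eq_bigl => x; rewrite inE.
Qed.

Lemma card_degL M : #|M| = \sum_x degL M x.
Proof.
transitivity (\sum_(x in setT) degL M x); last by apply: eq_bigl => x; rewrite inE.
rewrite (sum_degL M _ setT) (_ : nb_edges M _ (~: _) = 0) ?addn0 /nb_edges; last first.
  rewrite setCT; under eq_bigr do rewrite big_set0.
  by rewrite big1.
rewrite pair_big /= -sum1_card [LHS]big_mkcond [RHS]big_mkcond /=.
by apply: eq_bigr => -[x z] _; rewrite !inE; case: (_ \in M).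
Qed.

Lemma card_degR M : #|M| = \sum_z degR M z.
Proof. by rewrite card_degL /degL /degR exchange_big. Qed.

(** The residual digraph of a flow: forward arcs are edges that may still be added, backward arcs
    are edges that may be removed. *)
Definition residual A B M (a b : 'I_n + 'I_n) : bool :=
  match a, b with
  | inl x, inr z => (x, z) \in B :\: M
  | inr z, inl x => (x, z) \in M :\: A
  | _, _ => false
  end.

Lemma sum_pair_eqL (a x y : 'I_n) : \sum_v ((a, v) == (x, y)) = (a == x).
Proof.
rewrite (bigD1 y) //= xpair_eqE eqxx andbT big1 ?addn0 // => v /negPf vy.
by rewrite xpair_eqE vy andbF.
Qed.

Lemma sum_pair_eqR (a x y : 'I_n) : \sum_v ((v, a) == (x, y)) = (a == y).
Proof.
rewrite (bigD1 x) //= xpair_eqE eqxx /= big1 ?addn0 // => v /negPf vx.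
by rewrite xpair_eqE vx.
Qed.

(** Switching the edges of an alternating path changes degrees at its two ends only. The induction
    switches the first two edges and continues from the next left vertex. *)
Lemma augmenting_path A B p : forall M u z, A \subset M -> M \subset B ->
  path (residual A B M) (inl u) p -> uniq (inl u :: p) ->
  last (inl u) p = inr z ->
  exists M', [/\ A \subset M', M' \subset B,
    forall x, degL M' x = degL M x + (x == u) &
    forall y, degR M' y = degR M y + (y == z)].
Proof.
have [m] := ubnP (size p); elim: m p => // m IH p szp M u z AM MB.
case: p szp => [|[//|y] p] // szp /=.
rewrite !inE => /andP[/andP[uyM uyB]].
case: p szp => [|[x|//] p] szp /=.
  move=> _ _ [yz]; subst y; exists ((u, z) |: M); split.
  - exact: subset_trans AM (subsetUr _ _).
  - by rewrite subUset sub1set uyB.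
  - move=> a; rewrite -(sum_pair_eqL a u z) /degL -big_split /=.
    apply: eq_bigr => v _; rewrite !inE; case: eqP => [->|_] /=;
      by rewrite ?(negPf uyM) ?addn0.
  - move=> a; rewrite -(sum_pair_eqR a u z) /degR -big_split /=.
    apply: eq_bigr => v _; rewrite !inE; case: eqP => [->|_] /=;
      by rewrite ?(negPf uyM) ?addn0.
rewrite !inE => /andP[/andP[xyA xyM] pp] /andP[].
rewrite !negb_or => /andP[ux up] /and3P[/andP[_ yp] xp unp] lastp.
have xu : x != u by apply: contra ux => /eqP ->.
(* Both switched edges contain [y], which the rest of the simple path avoids, so that rest is still
   a residual path for [M1]. *)
pose M1 := ((u, y) |: M) :\ (x, y).
have M1E e : (e \in M1) + (e == (x, y)) = (e \in M) + (e == (u, y)).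
  rewrite !inE; case: eqP => [->|_] /=.
    by rewrite xyM xpair_eqE (negPf xu).
  by case: eqP => [->|_] /=; rewrite ?(negPf uyM) ?addn0.
have [|||||//|M' [AM' M'B dL dR]] := IH p _ M1 x z.
- exact: (ltnW (szp : (size p).+1 < m)).
- apply/subsetP => e eA; rewrite !inE (subsetP AM _ eA) orbT andbT.
  by apply: contraNneq xyA => <-.
- apply/subsetP => e; rewrite !inE => /andP[_ /orP[/eqP -> //|]].
  exact: (subsetP MB).
- move: pp; apply/sub_in_path: (allss (inl x :: p)) => a b.
  have ynot c : inr c \in inl x :: p -> c != y.
    by rewrite inE /= => cp; apply: contraNneq yp => <-.
  case: a => a; case: b => b //= ha hb; rewrite !inE !xpair_eqE.
    by rewrite (negPf (ynot _ hb)) !andbF.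
  by rewrite (negPf (ynot _ ha)) !andbF.
- by rewrite /= xp.
exists M'; split => //.
  move=> a; rewrite dL; apply/eqP; rewrite -(eqn_add2r 0) !addn0.
  rewrite -(sum_pair_eqL a x y) -(sum_pair_eqL a u y) /degL -!big_split /=.
  by apply/eqP; apply: eq_bigr => v _; exact: M1E.
move=> a; rewrite dR; congr addn; apply/eqP; rewrite -(eqn_add2r (a == y)).
rewrite -{1}(sum_pair_eqR a x y) -(sum_pair_eqR a u y) /degR -!big_split /=.
by apply/eqP; apply: eq_bigr => v _; exact: M1E.
Qed.

(** Max-flow min-cut: a largest [M] between the bounds with degrees at most [d] is regular, since
    otherwise the set reachable from a deficient vertex in the residual digraph violates the cut
    condition. *)
Lemma sandwich A B d : A \subset B ->
  (forall X Z, d * #|X| + nb_edges A (~: X) Z <= d * #|Z| + nb_edges B X (~: Z)) ->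
  exists M, [/\ A \subset M, M \subset B & regular_bip d M].
Proof.
move=> AB cut.
pose ok M := [&& A \subset M, M \subset B, [forall x, degL M x <= d] &
  [forall z, degR M z <= d]].
(* The cuts given by a single vertex bound the degrees of [A]. *)
have okA : ok A.
  rewrite /ok subxx AB /=; apply/andP; split; apply/forallP => v.
    have := cut (~: [set v]) setT; rewrite setCK setCT.
    rewrite (_ : nb_edges B _ set0 = 0); last first.
      by rewrite /nb_edges big1 // => x _; rewrite big_set0.
    have := sum_degL A [set v] setT; rewrite big_set1 => ->.
    rewrite (_ : nb_edges A _ (~: _) = 0); last first.
      by rewrite /nb_edges setCT big1 // => x _; rewrite big_set0.
    rewrite cardsT -(cardsC [set v]) cards1 mulnDr muln1 !addn0.
    by rewrite [d + _]addnC leq_add2l.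
  have := cut set0 [set v]; rewrite setC0 cards0 cards1.
  rewrite (_ : nb_edges B _ _ = 0); last by rewrite /nb_edges big_set0.
  have := sum_degR A setT [set v]; rewrite big_set1 => ->.
  rewrite (_ : nb_edges A (~: _) _ = 0); last by rewrite /nb_edges setCT big_set0.
  lia.
case: (@arg_maxnP _ A ok (fun M => #|M|) okA) => M /and4P[AM MB /forallP dL /forallP dR] maxM.
exists M; split => //; apply/regular_bipP.
(* Full left degrees suffice: both sides count the edges of [M], and the right degrees are at most
   [d]. *)
suff fullL x : degL M x = d.
  split => // z; apply/eqP; move: z; apply/forallP.
  have : \sum_z degR M z == \sum_(z : 'I_n) d.
    by rewrite -card_degR card_degL; apply/eqP; apply: eq_bigr.
  rewrite (leqif_sum (fun z _ => leqif_eq (dR z))).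
  by move=> /forallP h; apply/forallP => z; have := h z.
apply/eqP; rewrite eqn_leq dL leqNgt; apply/negP => ltx.
(* Reachable right vertices are full, or [M] could be augmented. Edges of [M] entering [Z] from
   outside [X] lie in [A], and edges of [B] leaving [X] outside [Z] lie in [M]. Thus [X] and [Z]
   contradict [cut]. *)
pose Rch := [set y | connect (residual A B M) (inl x) y].
pose X := [set a | inl a \in Rch]; pose Z := [set b | inr b \in Rch].
have xX : x \in X by rewrite !inE connect0.
have fullZ z : z \in Z -> degR M z = d.
  rewrite !inE => /connectP[p0 /shortenP[p pp up _] lastp].
  apply/eqP; rewrite eqn_leq dR leqNgt; apply/negP => ltz.
  have [M' [AM' M'B dL' dR']] := augmenting_path AM MB pp up (esym lastp).
  have : ok M'.
    rewrite /ok AM' M'B /=; apply/andP; split; apply/forallP => v.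
      by rewrite dL'; case: eqP => [->|_]; rewrite ?addn1 ?addn0.
    by rewrite dR'; case: eqP => [->|_]; rewrite ?addn1 ?addn0.
  move=> /maxM; rewrite !card_degL.
  have -> : \sum_a degL M' a = \sum_a degL M a + \sum_a (a == x).
    by rewrite -big_split; apply: eq_bigr => a _; rewrite dL'.
  by rewrite /= (bigD1 (P := predT) (F := fun a => nat_of_bool (a == x)) x) //= eqxx; lia.
have hZ := sum_degR M X Z; have hX := sum_degL M X Z.
have hZ' : nb_edges M (~: X) Z <= nb_edges A (~: X) Z.
  apply: leq_sum => a aX; apply: leq_sum => b bZ.
  have [abM|//] := boolP ((a, b) \in M).
  suff -> : (a, b) \in A by [].
  apply: contraLR aX => abA; rewrite !inE negbK in bZ *.
  by apply: connect_trans bZ (connect1 _); rewrite /= inE abA.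
have hX' : nb_edges B X (~: Z) <= nb_edges M X (~: Z).
  apply: leq_sum => a aX; apply: leq_sum => b bZ.
  have [abB|//] := boolP ((a, b) \in B).
  suff -> : (a, b) \in M by [].
  apply: contraLR bZ => abM; rewrite !inE negbK in aX *.
  by apply: connect_trans aX (connect1 _); rewrite /= inE abM.
have ltX : \sum_(a in X) degL M a < d * #|X|.
  rewrite mulnC -sum_nat_const (bigD1 x) //= [ltnRHS](bigD1 x) //= -addSn.
  by rewrite leq_add // leq_sum.
have eqZ : \sum_(z in Z) degR M z = d * #|Z|.
  by rewrite mulnC -sum_nat_const; apply: eq_bigr.
move: (cut X Z) ltX hZ' hX'; rewrite -eqZ hZ hX.
move: (d * _) (nb_edges M X Z) (nb_edges M (~: X) Z) (nb_edges M X (~: Z)) (nb_edges A _ _) (nb_edges B _ _).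
lia.
Qed.

End Sandwich.

(** * Connected vertex sets *)

Section Connected.
Variable n : nat.
Variable H : {set edge n}.
Local Notation vertex := ('I_n + 'I_n)%type.
Implicit Types (T C : {set vertex}) (x y v : vertex).

Definition adj x y : bool :=
  match x, y with
  | inl u, inr z => (u, z) \in H
  | inr z, inl u => (u, z) \in H
  | _, _ => false
  end.

Lemma adj_sym x y : adj x y = adj y x.
Proof. by case: x; case: y. Qed.

Definition bd T : {set edge n} :=
  [set e in H | (inl e.1 \in T) != (inr e.2 \in T)].

(* Connectedness, recorded through closed walks that traverse a spanning tree
   twice, so that the connected sets through a vertex can be counted. *)
Definition spanned T : Prop :=
  T != set0 /\ forall v, v \in T -> exists w : seq vertex,
    [/\ path adj v w, last v w = v, size w = (#|T|.-1).*2 & [set x in v :: w] = T].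

Lemma spanned1 v : spanned [set v].
Proof.
split; first by apply/set0Pn; exists v; rewrite inE.
move=> x; rewrite inE => /eqP ->{x}; exists [::]; split => //.
  by rewrite cards1.
by apply/setP => x; rewrite !inE.
Qed.

(** The detour from [x] to [y] and back is spliced into the closed walk, lengthening it by two; a
    walk based at [y] goes to [x], round, and back. *)
Lemma spannedU1 T x y : spanned T -> x \in T -> y \notin T -> adj x y ->
  spanned (y |: T).
Proof.
move=> [T0 hT] xT yT axy; split; first by apply/set0Pn; exists y; rewrite setU11.
have cT : (0 < #|T|)%N by rewrite card_gt0.
have cE : (#|y |: T|.-1).*2 = (#|T|.-1).*2.+2 by rewrite cardsU1 yT add1n -doubleS prednK.
move=> v; rewrite !inE => /orP[/eqP ->{v}|vT].
  have [w [pw lw sw Tw]] := hT x xT; exists (x :: rcons w y); split.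
  - by rewrite /= adj_sym axy rcons_path pw lw axy.
  - by rewrite /= last_rcons.
  - by rewrite /= size_rcons sw cE.
  - by apply/setP => z; rewrite -Tw !inE mem_rcons inE; do !case: (_ == _).
have [w [pw lw sw Tw]] := hT v vT.
have : x \in v :: w by rewrite -Tw inE in xT.
rewrite inE => /predU1P[xv|xw].
  rewrite {}xv in axy *; exists [:: y, v & w]; split => //.
  - by rewrite /= axy adj_sym axy pw.
  - by rewrite /= sw cE.
  - by apply/setP => z; rewrite -Tw !inE; do !case: (_ == _).
case/splitPr: w / xw pw lw sw Tw => w1 w2.
rewrite cat_path last_cat /= size_cat /= => /and3P[p1 a1 p2] lw sw Tw.
exists (w1 ++ [:: x, y, x & w2]); split.
- by rewrite cat_path /= p1 a1 axy adj_sym axy p2.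
- by rewrite last_cat.
- by rewrite size_cat /= cE -sw !addnS.
- apply/setP => z; rewrite -Tw !inE !mem_cat !inE.
  by case: (z == x); rewrite ?orbT //; case: (z == y); rewrite ?orbT.
Qed.

(** A spanned subset of [T] of maximal size works: an edge leaving it within [T] would enlarge it by
    [spannedU1]. *)
Lemma component_ex T : T != set0 -> exists C,
  [/\ C \subset T, spanned C & forall x y, x \in C -> y \in T -> y \notin C -> ~~ adj x y].
Proof.
case/set0Pn => v vT.
pose P (C : {set vertex}) := (C \subset T) && `[< spanned C >].
have P1 : P [set v] by rewrite /P sub1set vT; apply/asboolP; exact: spanned1.
case: (@arg_maxnP _ [set v] P (fun C => #|C|) P1) => C /andP[CT /asboolP sC] maxC.
exists C; split => // x y xC yT yC; apply/negP => axy.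
have /maxC : P (y |: C).
  rewrite /P subUset sub1set yT CT; apply/asboolP; exact: spannedU1 axy.
by rewrite /= cardsU1 yC add1n ltnn.
Qed.

(** The boundary of [T] is the disjoint union of the boundaries of a component [C] and of the
    remainder, and every edge keeps its side. Control of connected sets, all that the local lemma
    gives, therefore extends to all sets. *)
Lemma sum_bd_spanned (R : realDomainType) (g : edge n -> bool -> R) (N : nat) :
  (forall C, spanned C -> (#|C| <= N)%N ->
     \sum_(e in bd C) g e (inl e.1 \in C) <= 0) ->
  forall T, (#|T| <= N)%N -> \sum_(e in bd T) g e (inl e.1 \in T) <= 0.
Proof.
move=> hC T; have [m] := ubnP #|T|; elim: m T => // m IH T leT TN.
have [->|T0] := eqVneq T set0.
  by rewrite big1 // => e; rewrite !inE andbF.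
have [C [CT sC sepC]] := component_ex T0.
have C0 : (0 < #|C|)%N by case: sC => C0 _; rewrite card_gt0.
have cT : #|T| = (#|C| + #|T :\: C|)%N by rewrite -(cardsID C T) (setIidPr CT).
have hD := IH (T :\: C) ltac:(lia) ltac:(lia).
have {}hC := hC C sC ltac:(lia).
rewrite -[leRHS]addr0; apply: le_trans (lerD hC hD).
rewrite ![\sum_(e in bd _) _]big_mkcond -big_split /=.
rewrite le_eqVlt; apply/orP; left; apply/eqP; apply: eq_bigr => -[u z] _.
rewrite !inE /=.
have [eH|//] := boolP ((u, z) \in H); last by rewrite addr0.
have sep1 := sepC (inl u) (inr z); have sep2 := sepC (inr z) (inl u).
rewrite /= eH in sep1 sep2.
have CT' x := subsetP CT x.
move: sep1 sep2 (CT' (inl u)) (CT' (inr z)).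
case: (inl u \in C); case: (inr z \in C); case: (inl u \in T); case: (inr z \in T);
  rewrite /= ?addr0 ?add0r // => s1 s2 s3 s4;
  by [have := s3 isT | have := s4 isT | have := s1 isT isT isT | have := s2 isT isT isT].
Qed.

Fixpoint walks v l : seq (seq vertex) :=
  if l is l'.+1 then [seq y :: w | y <- enum (adj v), w <- walks y l'] else [:: [::]].

Lemma mem_walks v w : path adj v w -> w \in walks v (size w).
Proof.
elim: w v => //= y w IH v /andP[avy pw].
by apply/allpairsPdep; exists y, w; rewrite mem_enum IH.
Qed.

Lemma size_walks d v l : (forall x, #|adj x| <= d)%N -> (size (walks v l) <= d ^ l)%N.
Proof.
move=> hd; elim: l v => //= l IH v; rewrite size_allpairs_dep sumnE big_map.
apply: leq_trans (_ : \sum_(y <- enum (adj v)) d ^ l <= _)%N; first exact: leq_sum.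
by rewrite big_const_seq count_predT iter_addn_0 -cardE expnSr leq_mul2l hd orbT.
Qed.

(** A spanned set is recovered from its closed walk based at [v], so there are at most as many sets
    as walks. *)
Lemma card_spanned d v t : (forall x, #|adj x| <= d)%N ->
  (#|[set T : {set vertex} | [&& v \in T, `[< spanned T >] & #|T| == t]]| <= d ^ (t.-1).*2)%N.
Proof.
move=> hd; apply: leq_trans (size_walks v _ hd).
rewrite -(size_map (fun w => [set x in v :: w])).
apply: leq_trans (card_size _); apply: subset_leq_card; apply/subsetP => T.
rewrite inE => /and3P[vT /asboolP[_ /(_ v vT)[w [pw _ sw Tw]]] /eqP tT].
by rewrite -tT -sw; apply/mapP; exists w; rewrite ?mem_walks.
Qed.

(** By [card_spanned] the sets of size [t + 1] contribute at most [rho * (d^2 rho)^t], a geometric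
    series of ratio at most 1/2. *)
Lemma sum_spanned (R : realFieldType) d (rho : R) v :
  (forall x, #|adj x| <= d)%N -> 0 <= rho -> d%:R ^+ 2 * rho <= 2^-1 ->
  \sum_(T : {set vertex} | v \in T) (if `[< spanned T >] then rho ^+ #|T| else 0) <=
    2 * rho.
Proof.
move=> hd rho0 drho; rewrite -big_mkcondr /=.
have geo m : \sum_(t < m) (2^-1 : R) ^+ t <= 2.
  suff -> : \sum_(t < m) (2^-1 : R) ^+ t = 2 - 2 * 2^-1 ^+ m.
    by rewrite gerBl mulr_ge0 // exprn_ge0 // invr_ge0.
  elim: m => [|m IH]; first by rewrite big_ord0 expr0; ring.
  by rewrite big_ord_recr /= IH exprS; field.
rewrite (partition_big (fun T => inord #|T| : 'I_(#|{: vertex}|.+1)) predT) //=.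
rewrite big_ord_recl /= big1 ?add0r; last first.
  move=> T /andP[/andP[vT _]] /eqP /(congr1 val) /=.
  rewrite inordK ?ltnS ?max_card // => /eqP; rewrite cards_eq0 => /eqP T0.
  by rewrite T0 inE in vT.
apply: (@le_trans _ _ (\sum_(t < #|{: vertex}|) rho * 2^-1 ^+ t)); last first.
  by rewrite -big_distrr /= [leRHS]mulrC; apply: ler_wpM2l => //; exact: geo.
apply: ler_sum => t _.
apply: (@le_trans _ _ (\sum_(T in [set T : {set vertex} | [&& v \in T, `[< spanned T >] & #|T| == t.+1]])
   rho ^+ t.+1)).
  rewrite le_eqVlt; apply/orP; left; apply/eqP; apply: eq_big => [T|T].
    rewrite inE -andbA; congr [&& _, _ & _].
    by rewrite -val_eqE /= inordK ?ltnS ?max_card.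
  by rewrite -val_eqE /= inordK ?ltnS ?max_card // => /andP[_ /eqP ->].
rewrite sumr_const -[leLHS]mulr_natr exprS -mulrA; apply: ler_wpM2l => //.
have := card_spanned v t.+1 hd; rewrite -(ler_nat R) => h.
apply: le_trans (ler_wpM2l (exprn_ge0 _ rho0) h) _.
rewrite /= -mul2n natrX exprM -exprMn mulrC; apply: lerXn2r => //.
  by rewrite nnegrE mulr_ge0 // exprn_ge0.
by rewrite nnegrE invr_ge0.
Qed.

End Connected.

(** * Splitting a regular graph *)

Lemma bernoulli (R : realDomainType) (x : R) m : 0 <= x <= 1 -> 1 - m%:R * x <= (1 - x) ^+ m.
Proof.
move=> x01; have := @prod1B_ge R 'I_m predT (fun=> x) (fun=> x01).
by rewrite sumr_const prodr_const card_ord mulr_natl.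
Qed.

Definition expanding (R : realType) n (a : R) (r : nat) (H : {set edge n}) : Prop :=
  forall T : {set 'I_n + 'I_n}, (#|T| <= n)%N ->
    a * r%:R * #|T|%:R <= #|bd H T|%:R.

Section Split.
Variables (R : realType) (n r : nat) (H : {set edge n}) (a eta : R).
Local Notation vertex := ('I_n + 'I_n)%type.
Hypothesis r_gt0 : (0 < r)%N.
Hypothesis H_reg : regular_bip r H.
Hypothesis H_exp : expanding a r H.
Hypothesis a_ge0 : 0 <= a.
Hypothesis eta01 : 0 < eta <= 2^-1.
(** Connected sets of size [t] get local lemma weight [rho ^+ t]. At most [r ^ (2 (t - 1))] of them
    contain a given vertex, so order [r^-2] makes the weights summable. *)
Let rho : R := (8 * r%:R ^+ 2)^-1.
(** The tail bound per vertex of a set: the 4 pays for the four scores in [bad], the division by 2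
    for the product over neighbouring events. *)
Hypothesis tail : 4 * expR (- ((eta / 2) ^+ 2 / 32) * (a * r%:R)) <= rho / 2.
Implicit Types (T : {set vertex}) (f : {ffun edge n -> option bool}).

(* The colours Some false and Some true send an edge to the first, respectively
   the second part; None keeps it for the repair of the degrees. *)
Definition colour_weight (c : option bool) : R :=
  if c is Some _ then (1 - eta) / 2 else eta.

Lemma colour_weight_ge0 c : 0 <= colour_weight c.
Proof. by case/andP: eta01 => ? ?; case: c => [b|] /=; lra. Qed.

Lemma sum_option_bool (F : option bool -> R) :
  \sum_c F c = F None + F (Some false) + F (Some true).
Proof.
rewrite (bigD1 None) //= (bigD1 (Some false)) //= (bigD1 (Some true)) //=.
rewrite big1 ?addr0 ?addrA // => -[[]|] //.
Qed.

Lemma colour_weight_sum1 : \sum_c colour_weight c = 1.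
Proof. by rewrite sum_option_bool /=; field. Qed.

(* For [j = (true, b)] this score controls the cut condition of [sandwich] and
   for [j = (false, b)] the expansion of the edges of colour [Some b]; the
   shifts make its mean at most [- eta / 2]. *)
Definition score (j : bool * bool) (side : bool) (c : option bool) : R :=
  if j.1 then (if c == Some (side (+) j.2) then 1 else -1) + eta / 2
  else (if c == Some j.2 then -1 else 1) - 2 * eta.

Definition total_score j T f : R :=
  \sum_(e in bd H T) score j (inl e.1 \in T) (f e).

Definition bad T : {set {ffun edge n -> option bool}} :=
  if `[< spanned H T >] && (#|T| <= n)%N
  then \bigcup_j [set f | 0 <= total_score j T f] else set0.

Definition bad_wt T : R := if `[< spanned H T >] then rho ^+ #|T| else 0.

Lemma card_adj x : (#|adj H x| <= r)%N.
Proof.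
case: H_reg => hL hR; case: x => u.
  rewrite -[leqRHS](hL u).
  apply: leq_trans (leq_imset_card inr _); apply: subset_leq_card.
  apply/subsetP => -[z|z]; rewrite unfold_in //= => uz.
  by apply: imset_f; rewrite inE.
rewrite -[leqRHS](hR u).
apply: leq_trans (leq_imset_card inl _); apply: subset_leq_card.
apply/subsetP => -[z|z]; rewrite unfold_in //= => uz.
by apply: imset_f; rewrite inE.
Qed.

Lemma rho_gt0 : 0 < rho.
Proof. by rewrite invr_gt0 mulr_gt0 // exprn_gt0 // ltr0n. Qed.

Lemma rho_r : r%:R ^+ 2 * rho = 8^-1.
Proof.
rewrite /rho; field; rewrite pnatr_eq0; lia.
Qed.

Lemma rho_le : rho <= 8^-1.
Proof.
rewrite -rho_r ler_peMl ?(ltW rho_gt0) // -natrX ler1n expn_gt0 r_gt0 //.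
Qed.

Lemma bad_wt01 T : 0 <= bad_wt T <= 1.
Proof.
rewrite /bad_wt; case: ifP => _; last by rewrite lexx ler01.
have := rho_gt0; have := rho_le => h1 h2.
by rewrite exprn_ge0 ?exprn_ile1 //; lra.
Qed.

Lemma bad_wt_ge0 T : 0 <= bad_wt T.
Proof. by have /andP[] := bad_wt01 T. Qed.

Lemma bad_wt_lt1 T : bad_wt T < 1.
Proof.
rewrite /bad_wt; case: ifP => [/asboolP[T0 _]|_]; last exact: ltr01.
have := rho_gt0; have := rho_le => h1 h2.
by rewrite exprn_ilt1 ?cards_eq0 //; lra.
Qed.

Lemma bad_wt_sum v : \sum_(T : {set vertex} | v \in T) bad_wt T <= 2 * rho.
Proof.
apply: (@sum_spanned _ _ _ r); first exact: card_adj.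
  exact: ltW rho_gt0.
by rewrite rho_r; lra.
Qed.

Lemma score_le2 j s c : `|score j s c| <= 2.
Proof.
case/andP: eta01 => e0 e1.
rewrite ler_norml /score; case: j.1; case: ifP => _; apply/andP; split; lra.
Qed.

Lemma score_mean j s : \sum_c colour_weight c * score j s c <= - (eta / 2).
Proof.
case/andP: eta01 => e0 e1.
rewrite sum_option_bool /score /=; case: j => -[] /= [] /=; case: s => /=; lra.
Qed.

Lemma bad_det T : determined (bd H T) (bad T).
Proof.
move=> f g fg; rewrite /bad; case: ifP => _; last by rewrite !inE.
have E j : total_score j T f = total_score j T g.
  by apply: eq_bigr => e /fg ->.
by apply/bigcupP/bigcupP => -[j _]; rewrite inE ?E => h; exists j; rewrite // inE ?E.
Qed.

(** The closed neighbourhood: two boundaries can share an edge only if one set meets the closed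
    neighbourhood of the other. *)
Definition around T : {set vertex} := \bigcup_(x in T) (x |: [set y | adj H x y]).

Lemma card_around T : (#|around T| <= #|T| * r.+1)%N.
Proof.
rewrite /around -sum_nat_const.
apply: leq_trans (_ : \sum_(x in T) #|x |: [set y | adj H x y]| <= _)%N.
  apply: (big_rec2 (fun (A : {set vertex}) m => #|A| <= m)%N); first by rewrite cards0.
  move=> x A m _ /= le; by apply: leq_trans (leq_card_setU _ _) _; rewrite leq_add2l.
apply: leq_sum => x _; apply: leq_trans (leq_card_setU _ _) _.
by rewrite cards1 add1n ltnS cardsE card_adj.
Qed.

Lemma bd_meet_around T T' : bd H T :&: bd H T' != set0 -> T' :&: around T != set0.
Proof.
case/set0Pn => -[u z]; rewrite !inE /= => /andP[/andP[eH eT] /andP[_ eT']].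
have {eT'} [y yT' yE] : exists2 y, y \in T' & y = inl u \/ y = inr z.
  move: eT'; case: (boolP (inl u \in T')) => [uT _|_ zT].
    by exists (inl u); [|left].
  by exists (inr z); [apply: contraR zT => /negPf ->|right].
have {eT} [x xT xE] : exists2 x, x \in T & x = inl u \/ x = inr z.
  move: eT; case: (boolP (inl u \in T)) => [uT _|_ zT].
    by exists (inl u); [|left].
  by exists (inr z); [apply: contraR zT => /negPf ->|right].
apply/set0Pn; exists y; rewrite inE yT'; apply/bigcupP; exists x => //.
by rewrite !inE; case: xE yE => -> [] ->; rewrite ?eqxx //= ?eH ?orbT.
Qed.

Lemma mono_prod (P Q : pred {set vertex}) : (forall T, P T -> Q T) ->
  \prod_(T | Q T) (1 - bad_wt T) <= \prod_(T | P T) (1 - bad_wt T).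
Proof.
move=> PQ; rewrite big_mkcond [leRHS]big_mkcond /=; apply: ler_prod => T _.
have /andP[x0 x1] := bad_wt01 T.
by have := PQ T; case: (P T); case: (Q T) => h; apply/andP; split; (lra || have := h isT).
Qed.

Lemma prod_around_ge T :
  2^-1 ^+ #|T| <= \prod_(T' | bd H T :&: bd H T' != set0) (1 - bad_wt T').
Proof.
apply: le_trans (mono_prod (@bd_meet_around T)).
have r0 := rho_gt0; have r1 := rho_le.
apply: le_trans (prod_meet_ge _ bad_wt01 _ bad_wt_sum); last lra.
apply: (@le_trans _ _ ((1 - 2 * rho) ^+ (#|T| * r.+1))); last first.
  apply: ler_wiXn2l (card_around T); lra.
rewrite mulnC exprM; apply: lerXn2r; rewrite ?nnegrE ?invr_ge0 ?exprn_ge0 //.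
  lra.
apply: le_trans (bernoulli _ _); last by apply/andP; split; lra.
have rr := rho_r.
have rR : 1 <= r%:R :> R by rewrite ler1n.
rewrite -[r.+1%:R]natr1.
have : r%:R * rho <= 8^-1 by nra.
nra.
Qed.

(** Expansion supplies at least [a r #|T|] independent boundary edges, so [chernoff] bounds each of
    the four scores by [q ^+ #|T|]. Then [4 q <= rho / 2] leaves [2^-1 ^+ #|T|] for
    [prod_around_ge]. *)
Lemma Pr_bad T : Pr colour_weight (bad T) <=
  bad_wt T * \prod_(T' | bd H T :&: bd H T' != set0) (1 - bad_wt T').
Proof.
have pr0 : 0 <= \prod_(T' | bd H T :&: bd H T' != set0) (1 - bad_wt T').
  by apply: prodr_ge0 => T' _; have /andP[? ?] := bad_wt01 T'; lra.
rewrite /bad; case: ifP => [/andP[sT Tn]|_]; last first.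
  rewrite /Pr big_set0 mulr_ge0 //; by have /andP[] := bad_wt01 T.
apply: (@le_trans _ _ (rho ^+ #|T| * 2^-1 ^+ #|T|)); last first.
  by rewrite /bad_wt sT; apply: ler_wpM2l; [exact: exprn_ge0 (ltW rho_gt0)|exact: prod_around_ge].
have tail_q := tail; set q := expR _ in tail_q.
have T1 : (0 < #|T|)%N by move/asboolP: sT => [T0 _]; rewrite card_gt0.
have one j : Pr colour_weight [set f | 0 <= total_score j T f] <= q ^+ #|T|.
  apply: le_trans (@chernoff R _ _ colour_weight (bd H T)
    (fun e => score j (inl e.1 \in T)) (eta / 2)
    colour_weight_ge0 colour_weight_sum1 _ _ _) _.
  - by case/andP: eta01 => e0 e1; apply/andP; split; lra.
  - by move=> e c; exact: score_le2.
  - by move=> e _; exact: score_mean.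
  rewrite /q -expRM_natr ler_expR -mulrA.
  have := H_exp Tn; set m := #|bd H T|%:R => hm.
  have : 0 <= (eta / 2) ^+ 2 / 32 by rewrite divr_ge0 // sqr_ge0.
  set s := (eta / 2) ^+ 2 / 32 => s0; nra.
apply: (@le_trans _ _ (\sum_(j : bool * bool) q ^+ #|T|)).
  apply: le_trans (_ : \sum_j Pr colour_weight [set f | 0 <= total_score j T f] <= _); last exact: ler_sum.
  apply: (big_rec2 (fun (A : {set _}) m => Pr colour_weight A <= m)).
    by rewrite /Pr big_set0.
  move=> j A m _ le; apply: le_trans (PrU colour_weight_ge0 _ _) _.
  by rewrite lerD2l.
rewrite sumr_const card_prod card_bool -exprMn -[leLHS]mulr_natl.
apply: (@le_trans _ _ ((4 * q) ^+ #|T|)).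
  rewrite exprMn; apply: ler_wpM2r; first by rewrite exprn_ge0 // expR_ge0.
  by rewrite -natrX ler_nat; exact: (@leq_pexp2l 4 1).
have rp := rho_gt0; apply: lerXn2r => //; rewrite nnegrE.
  by rewrite mulr_ge0 // expR_ge0.
by rewrite divr_ge0 // ltW.
Qed.

Definition good : {set {ffun edge n -> option bool}} := avoid bad setT.

Lemma good_gt0 : 0 < Pr colour_weight good.
Proof.
exact: (local_lemma_gt0 colour_weight_ge0 colour_weight_sum1 bad_wt_ge0 bad_wt_lt1
  bad_det Pr_bad).
Qed.

Lemma good_score f j T : f \in good -> (#|T| <= n)%N -> total_score j T f <= 0.
Proof.
move=> /avoidP gf.
apply: (sum_bd_spanned (g := fun e s => score j s (f e)) (N := n)) => C sC Cn.
have := gf C (in_setT C); rewrite /bad Cn; move/asboolP: (sC) => -> /=.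
move=> nb; rewrite leNgt; apply: contra nb => /ltW s0.
by apply/bigcupP; exists j => //; rewrite inE.
Qed.

(** The edges of [S] have at most [2 #|S|] ends, and only the events of sets containing one of these
    ends involve an edge of [S]. *)
Lemma good_spread (S : {set edge n}) A : determined S A ->
  (1 - 2 * rho) ^+ (2 * #|S|) * Pr colour_weight (A :&: good) <=
  Pr colour_weight A * Pr colour_weight good.
Proof.
move=> dA.
have := local_lemma colour_weight_ge0 colour_weight_sum1 bad_wt_ge0 bad_wt_lt1
  bad_det Pr_bad dA.
apply: le_trans; apply: ler_wpM2r.
  by apply: Pr_ge0; exact: colour_weight_ge0.
pose U : {set vertex} := [set inl e.1 | e in S] :|: [set inr e.2 | e in S].
have r0 := rho_gt0; have r1 := rho_le.
apply: (@le_trans _ _ (\prod_(T : {set vertex} | T :&: U != set0) (1 - bad_wt T))).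
  apply: le_trans (prod_meet_ge _ bad_wt01 _ bad_wt_sum); last lra.
  apply: ler_wiXn2l; first by lra.
    by lra.
  apply: leq_trans (leq_card_setU _ _) _; rewrite mul2n -addnn.
  by apply: leq_add; exact: leq_imset_card.
apply: mono_prod => T; rewrite inE => /set0Pn[e]; rewrite !inE => /andP[eS /andP[_ eT]].
apply/set0Pn; case: (boolP (inl e.1 \in T)) eT => [eT _|_ eT].
  by exists (inl e.1); rewrite !inE eT /= (imset_f (fun e => inl e.1)).
have {}eT : inr e.2 \in T by apply: contraR eT => /negPf ->.
by exists (inr e.2); rewrite !inE eT /= (imset_f (fun e => inr e.2)) ?orbT.
Qed.

Lemma nb_edges_sum (M : {set edge n}) X Z :
  (nb_edges M X Z)%:R = \sum_(e : edge n) ((e \in M) && ((e.1 \in X) && (e.2 \in Z)))%:R :> R.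
Proof.
rewrite nb_edges_card -sum1_card natr_sum big_mkcond; apply: eq_bigr => e _.
by rewrite !inE; case: ifP.
Qed.

Hypothesis cut_large : 1 <= eta / 2 * (a * r%:R).

Definition cut_sign f (s : bool) e : R := if f e == Some s then 1 else -1.

(** The shift [eta / 2] in the score, summed over at least [a r #|T|] boundary edges, leaves a slack
    of [#|T|]. It pays for the rounding when [r] is odd. *)
Lemma good_cut f b T : f \in good -> (#|T| <= n)%N ->
  \sum_(e in bd H T) cut_sign f ((inl e.1 \in T) (+) b) e <= - #|T|%:R.
Proof.
move=> gf Tn; have := good_score (true, b) gf Tn.
rewrite /total_score /score /= big_split /= sumr_const -[_ *+ #|bd H T|]mulr_natr.
rewrite -/(cut_sign _ _ _); set s := \sum_(_ in _) _ => hs.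
have := H_exp Tn; set m := #|bd H T|%:R => hm.
have : 0 <= #|T|%:R :> R by [].
case/andP: eta01 => e0 e1.
set t := #|T|%:R in hm * => t0.
have h1 : 0 <= (eta / 2 * (a * r%:R) - 1) * t by rewrite mulr_ge0 // subr_ge0.
have h2 : 0 <= eta / 2 * (m - a * r%:R * t) by rewrite mulr_ge0 ?subr_ge0 //; lra.
lra.
Qed.

Variables (r1 r2 : nat).
Hypothesis rE : r = (r1 + r2)%N.
Hypothesis r12 : (r1 <= r2 <= r1.+1)%N.

(** Twice the cut condition of [sandwich], with the degree sums of [H] subtracted, is a bound on the
    signed boundary sum of [X] and [Z] taken as one vertex set. *)
Lemma good_sandwich f : f \in good -> exists M : {set edge n},
  [/\ [set e in H | f e == Some false] \subset M,
      M \subset [set e in H | f e != Some true] & regular_bip r1 M].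
Proof.
move=> gf; apply: sandwich => [|X Z].
  by apply/subsetP => e; rewrite !inE => /andP[-> /eqP ->].
set A := [set e in H | _]; set B := [set e in H | _].
pose T : {set vertex} := [set v | match v with inl x => x \in X | inr z => z \in Z end].
have TX : (#|X| <= #|T|)%N.
  rewrite -(card_imset (mem X) (@inl_inj 'I_n 'I_n)); apply: subset_leq_card.
  by apply/subsetP => _ /imsetP[x xX ->]; rewrite inE.
have TZ : (#|Z| <= #|T|)%N.
  rewrite -(card_imset (mem Z) (@inr_inj 'I_n 'I_n)); apply: subset_leq_card.
  by apply/subsetP => _ /imsetP[x xX ->]; rewrite inE.
have TCX : (#|~: X| <= #|~: T|)%N.
  rewrite -(card_imset (mem (~: X)) (@inl_inj 'I_n 'I_n)); apply: subset_leq_card.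
  by apply/subsetP => _ /imsetP[x xX ->]; rewrite !inE -in_setC.
have TCZ : (#|~: Z| <= #|~: T|)%N.
  rewrite -(card_imset (mem (~: Z)) (@inr_inj 'I_n 'I_n)); apply: subset_leq_card.
  by apply/subsetP => _ /imsetP[x xX ->]; rewrite !inE -in_setC.
have TT : (#|T| + #|~: T| = n + n)%N by rewrite cardsC card_sum card_ord.
have XX : (#|X| + #|~: X| = n)%N by rewrite cardsC card_ord.
have ZZ : (#|Z| + #|~: Z| = n)%N by rewrite cardsC card_ord.
have signE : \sum_(e in bd H T) cut_sign f (inl e.1 \in T) e =
    (nb_edges H X (~: Z))%:R - 2 * (nb_edges B X (~: Z))%:R +
    (2 * (nb_edges A (~: X) Z)%:R - (nb_edges H (~: X) Z)%:R).
  rewrite !nb_edges_sum !big_distrr /= -!sumrB -big_split /= big_mkcond.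
  apply: eq_bigr => -[u z] _; rewrite !inE /= /cut_sign.
  case: ((u, z) \in H) => /=; last by rewrite !mulr0 !subr0 addr0.
  by case: (u \in X); case: (z \in Z); case: (f (u, z)) => [[]|] /=; ring.
have [hL hR] := (regular_bipP _ _).1 H_reg.
have degX : (r * #|X| = nb_edges H X Z + nb_edges H X (~: Z))%N.
  by rewrite mulnC -sum_nat_const -(sum_degL H X Z); apply: eq_bigr => x _; rewrite hL.
have degZ : (r * #|Z| = nb_edges H X Z + nb_edges H (~: X) Z)%N.
  by rewrite mulnC -sum_nat_const -(sum_degR H X Z); apply: eq_bigr => x _; rewrite hR.
(* Expansion concerns sets of at most [n] of the [2 n] vertices; a larger [T] is replaced by its
   complement, which exchanges the sides, hence [b = true]. *)
have sgn_le : \sum_(e in bd H T) cut_sign f (inl e.1 \in T) e + (r2 - r1)%:R * #|Z|%:R <=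
    (r2 - r1)%:R * #|X|%:R.
  have d01 : (r2 - r1 = 0 \/ r2 - r1 = 1)%N by lia.
  have [Tn|Tn] := leqP #|T| n.
    have := good_cut false gf Tn.
    under eq_bigr do rewrite addbF.
    set sg := \sum_(_ in _) _ => hs.
    have : #|Z|%:R <= #|T|%:R :> R by rewrite ler_nat.
    have : 0 <= #|X|%:R :> R by [].
    have : 0 <= #|Z|%:R :> R by [].
    case: d01 => ->; lra.
  have Tn' : (#|~: T| <= n)%N by lia.
  have := good_cut true gf Tn'.
  have -> : bd H (~: T) = bd H T.
    apply/setP => e; rewrite !inE.
    by case: e => u z /=; case: (u \in X); case: (z \in Z).
  under eq_bigr => e _ do rewrite addbT inE negbK.
  set sg := \sum_(_ in _) _ => hs.
  have : #|~: X|%:R <= #|~: T|%:R :> R by rewrite ler_nat.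
  have : #|X|%:R + #|~: X|%:R = n%:R :> R by rewrite -natrD XX.
  have : #|Z|%:R + #|~: Z|%:R = n%:R :> R by rewrite -natrD ZZ.
  have : 0 <= #|~: X|%:R :> R by [].
  have : 0 <= #|~: Z|%:R :> R by [].
  case: d01 => ->; lra.
have r2E : r2%:R = r1%:R + (r2 - r1)%:R :> R by rewrite -natrD subnKC //; lia.
have rR : r%:R = r1%:R + r1%:R + (r2 - r1)%:R :> R by rewrite rE natrD r2E addrA.
move: degX degZ => /(congr1 (fun k => k%:R : R)) + /(congr1 (fun k => k%:R : R)).
rewrite !natrM !natrD rR => degX degZ.
rewrite -(ler_nat R) !natrD !natrM.
rewrite signE in sgn_le.
set o := (r2 - r1)%:R in degX degZ sgn_le *; lra.
Qed.

Lemma good_expansion f b T : f \in good -> (#|T| <= n)%N ->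
  (1 - 2 * eta) / 2 * #|bd H T|%:R <= #|[set e in bd H T | f e == Some b]|%:R.
Proof.
move=> gf Tn; have := good_score (false, b) gf Tn.
rewrite /total_score /score /=.
set N := #|[set e in bd H T | f e == Some b]|%:R.
have -> : \sum_(e in bd H T) ((if f e == Some b then -1 else 1) - 2 * eta) =
   (1 - 2 * eta) * #|bd H T|%:R - 2 * N.
  rewrite mulr_natr -sumr_const /N -sum1_card natr_sum big_distrr /=.
  rewrite [X in _ = _ - X](_ : _ = \sum_(e in bd H T) if f e == Some b then 2 else 0); last first.
    rewrite -big_mkcondr; apply: eq_big => [e|e _]; last by rewrite mulr1.
    by rewrite !inE.
  by rewrite -sumrB; apply: eq_bigr => e _; case: ifP => _; ring.
lra.
Qed.

(** An edge placed in a given half has the colour of that half or the reserve colour, whatever the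
    correction is: probability [(1 - eta) / 2 + eta] per edge. *)
Lemma Pr_avoid_colours (S1 S2 : {set edge n}) : [disjoint S1 & S2] ->
  Pr colour_weight [set f : {ffun edge n -> option bool} |
                          [forall (e | e \in S1), f e != Some true] &&
                          [forall (e | e \in S2), f e != Some false]] <=
  ((1 + eta) / 2) ^+ (#|S1| + #|S2|).
Proof.
move=> dis.
pose h (e : edge n) (c : option bool) : R :=
  (((e \in S1) ==> (c != Some true)) && ((e \in S2) ==> (c != Some false)))%:R.
have h0 e c : 0 <= h e c by [].
apply: (@le_trans _ _ (\sum_f weight colour_weight f * \prod_e h e (f e))).
  rewrite /Pr big_mkcond; apply: ler_sum => f _.
  have w0 := weight_ge0 colour_weight_ge0 f.
  rewrite inE; case: ifP => [/andP[/forallP f1 /forallP f2]|_].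
    by rewrite big1 ?mulr1 // => e _; rewrite /h f1 f2.
  by rewrite mulr_ge0 // prodr_ge0.
rewrite Pr_prod -cardsUI.
have -> : S1 :&: S2 = set0 by apply/eqP; rewrite setI_eq0.
rewrite cards0 addn0 -prodr_const [leRHS]big_mkcond /=.
apply: ler_prod => e _; case/andP: eta01 => e0 e1; rewrite sum_option_bool /h /= inE.
have := disjointFr dis (x := e).
by case: (e \in S1); case: (e \in S2) => /=; rewrite ?eqxx /= => dd;
  try (by have := dd isT); apply/andP; split; lra.
Qed.

(** [nu] is the image of the colouring conditioned on [good] under an arbitrary choice [Phi] of
    corrections. Conditioning costs [(1 - 2 rho) ^- 2] per edge. *)
Lemma split_distr : exists nu : {set edge n} -> R,
  [/\ is_distr nu,
    forall M, 0 < nu M -> [/\ M \subset H, regular_bip r1 M,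
       forall T, (#|T| <= n)%N -> (1 - 2 * eta) / 2 * #|bd H T|%:R <= #|bd M T|%:R &
       forall T, (#|T| <= n)%N -> (1 - 2 * eta) / 2 * #|bd H T|%:R <= #|bd (H :\: M) T|%:R] &
    forall S1 S2 : {set edge n},
      \sum_(M : {set edge n} | (S1 \subset M) && (S2 \subset H :\: M)) nu M <=
      ((1 + eta) / 2 / (1 - 2 * rho) ^+ 2) ^+ (#|S1| + #|S2|)].
Proof.
have /choice[Phi PhiP] : forall f, exists M : {set edge n}, f \in good ->
    [/\ [set e in H | f e == Some false] \subset M,
      M \subset [set e in H | f e != Some true] & regular_bip r1 M].
  move=> f; have [gf|gf] := boolP (f \in good); last by exists set0.
  by have [M hM] := good_sandwich gf; exists M.
have g0 := good_gt0; set P := Pr colour_weight in g0.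
have w0 := weight_ge0 colour_weight_ge0 (E := edge n).
have r0 := rho_gt0; have rr1 := rho_le.
pose nu (M : {set edge n}) := (\sum_(f in good | Phi f == M) weight colour_weight f) / P good.
have nuE (Q : pred {set edge n}) :
    \sum_(M | Q M) nu M = (\sum_(f in good | Q (Phi f)) weight colour_weight f) / P good.
  rewrite -big_distrl /=; congr (_ / _).
  rewrite [RHS](partition_big Phi Q) //=; last by move=> f /andP[].
  apply: eq_bigr => M QM; apply: eq_bigl => f.
  by rewrite -andbA; congr andb; case: eqP => [->|]; rewrite ?QM ?andbF.
exists nu; split.
- split=> [M|]; first by apply: divr_ge0; [exact: sumr_ge0|exact: ltW].
  rewrite nuE (_ : \sum_(f in good | _) _ = P good) ?divff ?gt_eqF //.
  by apply: eq_bigl => f; rewrite andbT.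
- move=> M; rewrite /nu => nu0.
  have [f /andP[gf /eqP fM]] : exists f, (f \in good) && (Phi f == M).
    apply/existsP; apply: contraLR nu0.
    rewrite negb_exists => /forallP h.
    by rewrite big_pred0 ?mul0r ?ltxx // => f /=; apply: negbTE; exact: (h f).
  have [AM MB reg] := PhiP f gf; rewrite fM in AM MB reg.
  split=> // [|T Tn|T Tn].
  + by apply: subset_trans MB _; apply/subsetP => e; rewrite inE => /andP[].
  + apply: le_trans (good_expansion false gf Tn) _; rewrite ler_nat.
    apply: subset_leq_card; apply/subsetP => e; rewrite !inE => /andP[/andP[eH ->] ec].
    by rewrite (subsetP AM) // inE eH.
  + apply: le_trans (good_expansion true gf Tn) _; rewrite ler_nat.
    apply: subset_leq_card; apply/subsetP => e; rewrite !inE => /andP[/andP[eH ->] ec].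
    rewrite eH !andbT; apply: contraL ec => /(subsetP MB).
    by rewrite inE => /andP[].
- move=> S1 S2; rewrite nuE.
  have q0 : 0 <= (1 + eta) / 2 / (1 - 2 * rho) ^+ 2.
    by case/andP: eta01 => e0 e1; rewrite !divr_ge0 ?sqr_ge0 //; lra.
  have [dis|ndis] := boolP [disjoint S1 & S2]; last first.
    rewrite big_pred0 ?mul0r ?exprn_ge0 // => f.
    apply: contraNF ndis => /and3P[_ s1 s2].
    apply: disjointWl s1 _; rewrite disjoint_sym; apply: disjointWl s2 _.
    by rewrite -setI_eq0 setIDAC setDIl setDv setI0.
  pose A := [set f : {ffun edge n -> option bool} |
    [forall (e | e \in S1), f e != Some true] && [forall (e | e \in S2), f e != Some false]].
  have dA : determined (S1 :|: S2) A.
    have half (f g : {ffun edge n -> option bool}) :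
        {in S1 :|: S2, f =1 g} -> f \in A -> g \in A.
      move=> fg; rewrite !inE => /andP[/forallP h1 /forallP h2].
      apply/andP; split; apply/forallP => e; apply/implyP => eS.
        by rewrite -fg ?inE ?eS //; have := h1 e; rewrite eS.
      by rewrite -fg ?inE ?eS ?orbT //; have := h2 e; rewrite eS.
    by move=> f g fg; apply/idP/idP; apply: half => // e eS; rewrite fg.
  have cS : #|S1 :|: S2| = (#|S1| + #|S2|)%N.
    by rewrite -cardsUI; move: dis; rewrite -setI_eq0 => /eqP ->; rewrite cards0 addn0.
  have := good_spread dA; rewrite cS -/P.
  have := Pr_avoid_colours dis; rewrite -/A -/P.
  set s := (#|S1| + #|S2|)%N => hA hs.
  (* [Phi f] avoids the colour [Some true] and contains all edges of [H] of colour [Some false], so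
     the event about [Phi f] implies an event about colours alone. *)
  have sub : \sum_(f in good | (S1 \subset Phi f) && (S2 \subset H :\: Phi f))
      weight colour_weight f <= P (A :&: good).
    rewrite /P /Pr big_mkcond [leRHS]big_mkcond; apply: ler_sum => f _.
    case: ifP => [/and3P[gf s1 s2]|_]; last by case: ifP.
    rewrite inE gf andbT inE; have [AM MB _] := PhiP f gf.
    rewrite (_ : _ && _ = true) //; apply/andP; split; apply/forallP => e; apply/implyP => eS.
      by have /(subsetP s1)/(subsetP MB) := eS; rewrite inE => /andP[].
    have := subsetP s2 _ eS; rewrite inE => /andP[eM eH].
    by apply: contra eM => ec; apply: (subsetP AM); rewrite inE eH.
  rewrite ler_pdivrMr //; apply: le_trans sub _.
  have rp : 0 < (1 - 2 * rho) ^+ (2 * s) by rewrite exprn_gt0 //; lra.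
  rewrite -(ler_pM2l rp); apply: le_trans hs _.
  rewrite mulrA; apply: ler_wpM2r; first exact: ltW.
  apply: le_trans hA _.
  rewrite exprM -exprMn [X in _ <= X ^+ _]mulrC divfK // gt_eqF // exprn_gt0 //; lra.
Qed.

End Split.

(** * Spread 1-factorisations *)

Definition spread_factorisation (R : realType) n r (H : {set edge n}) (q : R)
    (kappa : {ffun 'I_r -> {set edge n}} -> R) : Prop :=
  [/\ is_distr kappa, forall F, 0 < kappa F -> one_factorisation H F &
    forall S : {ffun 'I_r -> {set edge n}},
      \sum_(F : {ffun 'I_r -> {set edge n}} | [forall c, S c \subset F c]) kappa F
        <= q ^+ (\sum_(c < r) #|S c|)].

Section Koenig.
Variable n : nat.

Lemma degLD (M H : {set edge n}) x : M \subset H ->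
  (degL M x + degL (H :\: M) x)%N = degL H x.
Proof.
move=> MH; rewrite /degL -big_split; apply: eq_bigr => z _ /=; rewrite inE.
have := subsetP MH (x, z); case: (_ \in M); case: (_ \in H) => //= h.
by have := h isT.
Qed.

Lemma degRD (M H : {set edge n}) x : M \subset H ->
  (degR M x + degR (H :\: M) x)%N = degR H x.
Proof.
move=> MH; rewrite /degR -big_split; apply: eq_bigr => z _ /=; rewrite inE.
have := subsetP MH (z, x); case: (_ \in M); case: (_ \in H) => //= h.
by have := h isT.
Qed.

Lemma regular_bipD r1 r2 (M H : {set edge n}) : M \subset H ->
  regular_bip (r1 + r2) H -> regular_bip r1 M -> regular_bip r2 (H :\: M).
Proof.
move=> MH /regular_bipP[HL HR] /regular_bipP[ML MR]; apply/regular_bipP; split=> x.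
  by apply/eqP; rewrite -(eqn_add2l r1) -{1}(ML x) degLD // HL.
by apply/eqP; rewrite -(eqn_add2l r1) -{1}(MR x) degRD // HR.
Qed.

(** Perfect matchings are peeled off one by one: [sandwich] with [d = 1] and an empty lower bound,
    its cut condition following from double counting. *)
Lemma koenig r (H : {set edge n}) : regular_bip r H ->
  exists F : {ffun 'I_r -> {set edge n}}, one_factorisation H F.
Proof.
elim: r H => [|r IH] H reg.
  exists [ffun => set0]; split; [by case|split; first by case].
  rewrite big_ord0; apply/esym/eqP; rewrite -cards_eq0 card_degL.
  have [hL _] := (regular_bipP _ _).1 reg.
  by apply/eqP; rewrite big1.
have [hL hR] := (regular_bipP _ _).1 reg.
have [||M [_ MH regM]] := @sandwich n set0 H 1; first exact: sub0set.
  move=> X Z; have -> : nb_edges set0 (~: X) Z = 0%N.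
    by rewrite /nb_edges big1 // => x _; rewrite big1 // => z _; rewrite inE.
  have := sum_degL H X Z; rewrite (eq_bigr (fun=> r.+1)) => [|x _]; last exact: hL.
  have := sum_degR H X Z; rewrite (eq_bigr (fun=> r.+1)) => [|x _]; last exact: hR.
  rewrite !sum_nat_const; move: (nb_edges _ _ _) (nb_edges _ _ _) (nb_edges _ _ _) => a b c e1 e2.
  rewrite !mul1n addn0 -(leq_pmul2r (ltn0Sn r)) mulnDl e2 e1 -addnA leq_add2l.
  by rewrite (leq_trans (leq_pmulr _ (ltn0Sn r))) // leq_addl.
have {}IH := IH _ (regular_bipD (r1 := 1) MH reg regM).
case: IH => F [FM [Fdis FH]].
pose G : {ffun 'I_r.+1 -> {set edge n}} :=
  [ffun c => if unlift ord0 c is Some j then F j else M].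
have G0 : G ord0 = M by rewrite ffunE unlift_none.
have GS j : G (lift ord0 j) = F j by rewrite ffunE liftK.
have MF j : [disjoint M & F j].
  rewrite -setI_eq0; apply/eqP/setP => e; rewrite !inE.
  apply/negP => /andP[eM eF]; have : e \in H :\: M.
    by rewrite -FH; apply/bigcupP; exists j.
  by rewrite inE eM.
exists G; split; [|split].
- by move=> c; case: (unliftP ord0 c) => [j|] ->; rewrite ?G0 ?GS.
- move=> c c'; case: (unliftP ord0 c) => [j|] ->; case: (unliftP ord0 c') => [j'|] ->;
    rewrite ?G0 ?GS ?eqxx //; last by rewrite disjoint_sym.
  by rewrite (inj_eq (@lift_inj _ _)); exact: Fdis.
- rewrite big_ord_recl G0 (eq_bigr F) => [|j _]; last exact: GS.
  by rewrite FH -{1}(setIidPr MH) setID.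
Qed.

End Koenig.

Section SpreadFactorisations.
Variables (R : realType) (n : nat).
Implicit Types (H M : {set edge n}).

Lemma card_bigcup_disjoint r (S : {ffun 'I_r -> {set edge n}}) :
  (forall c c', c != c' -> [disjoint S c & S c']) ->
  #|\bigcup_c S c| = (\sum_c #|S c|)%N.
Proof.
move=> dis; rewrite -sum1_card partition_disjoint_bigcup //.
by apply: eq_bigr => c _; rewrite sum1_card.
Qed.

(** The classes are disjoint and lie in [H], so the event is void unless the [S c] are disjoint
    subsets of [H]. This allows a spread bound for the union of the [S c] to be used with exponent
    the sum of their sizes. *)
Lemma spread_factorisation_supp r H q (kappa : {ffun 'I_r -> {set edge n}} -> R)
    (S : {ffun 'I_r -> {set edge n}}) :
  spread_factorisation H q kappa ->
  ~~ ((\bigcup_c S c \subset H) && (#|\bigcup_c S c| == \sum_c #|S c|)%N) ->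
  \sum_(F : {ffun 'I_r -> {set edge n}} | [forall c, S c \subset F c]) kappa F = 0.
Proof.
move=> [[k0 k1] kF _] nS; apply: big1 => F /forallP SF.
apply/eqP; have [//|kn0] := eqVneq; have {kn0} kpos : 0 < kappa F by rewrite lt_def kn0 k0.
have [_ [dis FH]] := kF F kpos.
case/negP: nS; apply/andP; split.
  by rewrite -FH; apply/bigcupsP => c _; apply: (bigcup_max c) => //; exact: SF.
apply/eqP/card_bigcup_disjoint => c c' cc'.
exact: disjointWl (SF c) (disjointWr (SF c') (dis c c' cc')).
Qed.

Lemma spread_factorisation_ge1 r H (q : R) : 1 <= q -> regular_bip r H ->
  exists kappa, @spread_factorisation R n r H q kappa.
Proof.
move=> q1 /koenig[F0 F0P]; exists (fun F => (F == F0)%:R); split.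
- split; first by move=> F; exact: ler0n.
  by rewrite (bigD1 F0) //= eqxx big1 ?addr0 // => F /negPf ->.
- by move=> F; case: eqP => [-> //|_]; rewrite ltxx.
- move=> S; apply: (@le_trans _ _ 1); last exact: exprn_ege1.
  have sum1 : \sum_F (F == F0)%:R = 1 :> R.
    by rewrite (bigD1 F0) //= eqxx big1 ?addr0 // => F /negPf -> //.
  rewrite -[leRHS]sum1 big_mkcond; apply: ler_sum => F _.
  by case: ifP => _; rewrite ?lexx ?ler0n.
Qed.

Lemma sum_ffun_split (T : finType) r1 r2 (G : {ffun 'I_r1 -> T} -> {ffun 'I_r2 -> T} -> R) :
  \sum_(F : {ffun 'I_(r1 + r2) -> T})
     G [ffun c => F (lshift r2 c)] [ffun c => F (rshift r1 c)] =
  \sum_F1 \sum_F2 G F1 F2.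
Proof.
rewrite pair_big /=.
pose join (p : {ffun 'I_r1 -> T} * {ffun 'I_r2 -> T}) : {ffun 'I_(r1 + r2) -> T} :=
  [ffun c => match split c with inl i => p.1 i | inr j => p.2 j end].
pose cut (F : {ffun 'I_(r1 + r2) -> T}) :=
  ([ffun c => F (lshift r2 c)] : {ffun 'I_r1 -> T},
   [ffun c => F (rshift r1 c)] : {ffun 'I_r2 -> T}).
have cutK : cancel cut join.
  move=> F; apply/ffunP => c; rewrite ffunE.
  by case: (splitP c) => j cj; rewrite ffunE; congr (F _); apply: val_inj.
have joinK : cancel join cut.
  move=> [F1 F2]; rewrite /cut; congr pair; apply/ffunP => c; rewrite !ffunE.
    by rewrite (unsplitK (inl c)).
  by rewrite (unsplitK (inr c)).
by rewrite [RHS](reindex cut) //; exists join => x _.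
Qed.

(** Draw [M] from [nu], factorise [M] and its complement in [H] independently, and juxtapose the
    colours. On either side the spread of the split multiplies that of the factorisation. *)
Lemma spread_factorisation_combine r1 r2 H (q1 q2 s1 s2 q : R) (nu : {set edge n} -> R) :
  0 <= q1 -> 0 <= q2 -> 0 <= s1 -> 0 <= s2 -> q1 * s1 <= q -> q2 * s2 <= q ->
  is_distr nu ->
  (forall M, 0 < nu M -> M \subset H) ->
  (forall S1 S2 : {set edge n},
      \sum_(M : {set edge n} | (S1 \subset M) && (S2 \subset H :\: M)) nu M <=
        s1 ^+ #|S1| * s2 ^+ #|S2|) ->
  (forall M, 0 < nu M -> exists kappa, @spread_factorisation R n r1 M q1 kappa) ->
  (forall M, 0 < nu M -> exists kappa, @spread_factorisation R n r2 (H :\: M) q2 kappa) ->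
  exists kappa, @spread_factorisation R n (r1 + r2) H q kappa.
Proof.
move=> q10 q20 s10 s20 le1 le2 [nu0 nu1] nuH nuS ex1 ex2.
have /choice[k1 k1P] : forall M, exists kappa, 0 < nu M -> @spread_factorisation R n r1 M q1 kappa.
  move=> M; have [/ex1[k hk]|_] := boolP (0 < nu M); first by exists k.
  by exists (fun=> 0).
have /choice[k2 k2P] : forall M, exists kappa, 0 < nu M ->
    @spread_factorisation R n r2 (H :\: M) q2 kappa.
  move=> M; have [/ex2[k hk]|_] := boolP (0 < nu M); first by exists k.
  by exists (fun=> 0).
pose lpart (F : {ffun 'I_(r1 + r2) -> {set edge n}}) : {ffun 'I_r1 -> {set edge n}} :=
  [ffun c => F (lshift r2 c)].
pose rpart (F : {ffun 'I_(r1 + r2) -> {set edge n}}) : {ffun 'I_r2 -> {set edge n}} :=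
  [ffun c => F (rshift r1 c)].
have nu_cases M : nu M = 0 \/ 0 < nu M.
  by rewrite lt_def nu0 andbT; case: eqVneq; [left|right].
pose kappa F := \sum_M nu M * (k1 M (lpart F) * k2 M (rpart F)).
have term0 M F : 0 <= nu M * (k1 M (lpart F) * k2 M (rpart F)).
  have [->|nuM] := nu_cases M; first by rewrite mul0r.
  have [[p1 _] _ _] := k1P M nuM; have [[p2 _] _ _] := k2P M nuM.
  by rewrite !mulr_ge0.
exists kappa; split.
- split=> [F|]; first exact: sumr_ge0.
  rewrite exchange_big /= -nu1; apply: eq_bigr => M _.
  rewrite -big_distrr /= (sum_ffun_split (fun F1 F2 => k1 M F1 * k2 M F2)).
  have [->|nuM] := nu_cases M; first by rewrite mul0r.
  have [[_ p1] _ _] := k1P M nuM; have [[_ p2] _ _] := k2P M nuM.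
  under eq_bigr do rewrite -big_distrr /= p2 mulr1.
  by rewrite p1 mulr1.
- move=> F kF.
  have [M] : exists M, 0 < nu M * (k1 M (lpart F) * k2 M (rpart F)).
    apply/existsP; apply: contraLR kF; rewrite negb_exists => /forallP h.
    rewrite /kappa big1 ?ltxx // => M _; apply/eqP.
    by have := h M; rewrite lt_def term0 andbT negbK.
  have [->|nuM] := nu_cases M; first by rewrite mul0r ltxx.
  have [[p1 _] f1 _] := k1P M nuM; have [[p2 _] f2 _] := k2P M nuM.
  rewrite pmulr_rgt0 // => kk.
  have [/f1[M1 [dis1 U1]] /f2[M2 [dis2 U2]]] :
      0 < k1 M (lpart F) /\ 0 < k2 M (rpart F).
    rewrite !lt_def p1 p2 !andbT; split; apply: contraTneq kk => ->;
      by rewrite ?mul0r ?mulr0 ltxx.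
  have FL i : lpart F i = F (lshift r2 i) by rewrite ffunE.
  have FR i : rpart F i = F (rshift r1 i) by rewrite ffunE.
  have dis12 i j : [disjoint lpart F i & rpart F j].
    rewrite -setI_eq0; apply/eqP/setP => e; rewrite !inE.
    apply/negP => /andP[e1 e2]; have : e \in H :\: M.
      by rewrite -U2; apply/bigcupP; exists j.
    by rewrite inE -U1; case/andP => /bigcupP[]; exists i.
  split; [|split].
  + by move=> c; case: (split_ordP c) => j ->; rewrite -?FL -?FR.
  + move=> c c'; case: (split_ordP c) => i ->; case: (split_ordP c') => j ->;
      rewrite -?FL -?FR => ij.
    * by apply: dis1; apply: contra ij => /eqP ->.
    * exact: dis12.
    * by rewrite disjoint_sym; exact: dis12.
    * by apply: dis2; apply: contra ij => /eqP ->.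
  + rewrite big_split_ord /=.
    have -> : \bigcup_i F (lshift r2 i) = M by rewrite -U1; apply: eq_bigr => i _; rewrite FL.
    have -> : \bigcup_i F (rshift r1 i) = H :\: M by rewrite -U2; apply: eq_bigr => i _; rewrite FR.
    by rewrite -{1}(setIidPr (nuH M nuM)) setID.
- move=> S.
  pose P1 M := \sum_(F1 : {ffun 'I_r1 -> {set edge n}} | [forall c, lpart S c \subset F1 c]) k1 M F1.
  pose P2 M := \sum_(F2 : {ffun 'I_r2 -> {set edge n}} | [forall c, rpart S c \subset F2 c]) k2 M F2.
  pose U1 := \bigcup_c lpart S c; pose U2 := \bigcup_c rpart S c.
  pose n1 := (\sum_c #|lpart S c|)%N; pose n2 := (\sum_c #|rpart S c|)%N.
  have -> : (\sum_c #|S c|)%N = (n1 + n2)%N.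
    by rewrite big_split_ord /=; congr addn; apply: eq_bigr => c _; rewrite ffunE.
  have condE (F : {ffun 'I_(r1 + r2) -> {set edge n}}) : [forall c, S c \subset F c] =
      [forall c, lpart S c \subset lpart F c] && [forall c, rpart S c \subset rpart F c].
    apply/forallP/andP => [h|[/forallP h1 /forallP h2] c].
      by split; apply/forallP => c; rewrite !ffunE.
    case: (split_ordP c) => j ->; first by have := h1 j; rewrite !ffunE.
    by have := h2 j; rewrite !ffunE.
  have -> : \sum_(F : {ffun 'I_(r1 + r2) -> {set edge n}} | [forall c, S c \subset F c]) kappa F =
      \sum_M nu M * (P1 M * P2 M).
    rewrite exchange_big /=; apply: eq_bigr => M _.
    rewrite -big_distrr /=; congr (_ * _).
    rewrite /P1 /P2 big_distrlr /= big_mkcond [RHS]big_mkcond.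
    under [RHS]eq_bigr do rewrite big_mkcond /=.
    pose G (F1 : {ffun 'I_r1 -> {set edge n}}) (F2 : {ffun 'I_r2 -> {set edge n}}) :=
      if [forall c, lpart S c \subset F1 c] && [forall c, rpart S c \subset F2 c]
      then k1 M F1 * k2 M F2 else 0.
    transitivity (\sum_F G (lpart F) (rpart F)).
      by apply: eq_bigr => F _; rewrite condE.
    rewrite (sum_ffun_split G); apply: eq_bigr => F1 _; rewrite /G.
    by case: ifP => _ //=; rewrite big1.
  (* By [spread_factorisation_supp] only these [M] contribute; the size conditions identify the
     exponents of [nuS] with [n1] and [n2]. *)
  apply: (@le_trans _ _ (\sum_(M : {set edge n} | (U1 \subset M) && (U2 \subset H :\: M) &&
      ((#|U1| == n1) && (#|U2| == n2))) nu M * (q1 ^+ n1 * q2 ^+ n2))).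
    rewrite [leRHS]big_mkcond; apply: ler_sum => M _.
    have [->|nuM] := nu_cases M; first by rewrite !mul0r; case: ifP.
    have h1 := k1P M nuM; have h2 := k2P M nuM.
    have P1_0 : 0 <= P1 M by case: h1 => [[p1 _] _ _]; apply: sumr_ge0.
    have P2_0 : 0 <= P2 M by case: h2 => [[p2 _] _ _]; apply: sumr_ge0.
    have [c1|c1] := boolP ((U1 \subset M) && (#|U1| == n1)); last first.
      rewrite /P1 (spread_factorisation_supp h1 c1) mul0r mulr0; case: ifP => // _.
      by rewrite !mulr_ge0 ?exprn_ge0.
    have [c2|c2] := boolP ((U2 \subset H :\: M) && (#|U2| == n2)); last first.
      rewrite /P2 (spread_factorisation_supp h2 c2) !mulr0; case: ifP => // _.
      by rewrite !mulr_ge0 ?exprn_ge0.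
    move: c1 c2 => /andP[-> ->] /andP[-> ->] /=.
    apply: ler_wpM2l => //; apply: ler_pM => //.
      by case: h1 => _ _; apply.
    by case: h2 => _ _; apply.
  have [/andP[/eqP c1 /eqP c2]|nc] := boolP ((#|U1| == n1) && (#|U2| == n2)); last first.
    rewrite big_pred0 => [|M]; last by rewrite andbF.
    by rewrite exprn_ge0 // (le_trans _ le1) // mulr_ge0.
  under eq_bigl do rewrite andbT.
  rewrite -big_distrl /=; apply: le_trans (ler_wpM2r _ (nuS U1 U2)) _.
    by rewrite mulr_ge0 ?exprn_ge0.
  rewrite c1 c2 mulrACA [s1 ^+ _ * _]mulrC [s2 ^+ _ * _]mulrC -!exprMn exprD.
  by apply: ler_pM; rewrite ?exprn_ge0 ?mulr_ge0 //; apply: lerXn2r;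
    rewrite ?nnegrE ?mulr_ge0 //; rewrite (le_trans _ le1) ?(le_trans _ le2) ?mulr_ge0.
Qed.

End SpreadFactorisations.

(** * Iterated halving *)

Definition large_level (k : nat) : bool := (2 ^ 17 * k ^ 4 * (2 * k + 8) <= 2 ^ k)%N.

Lemma expR_halfN (R : realType) m : expR (- m%:R) <= (2^-1 : R) ^+ m.
Proof.
rewrite expRN -[m%:R]mulr1 expRM_natl -exprVn.
apply: lerXn2r; rewrite ?nnegrE ?invr_ge0 ?expR_ge0 //.
rewrite lef_pV2 ?posrE ?expR_gt0 //.
by have := expR_ge1Dx (1 : R); lra.
Qed.

(** Three errors fit into one factor [1 + e]: the reserve costs [e / 8], the conditioning about
    [4 rho <= e / 16], and rounding [r / 2] down to [q] a relative [1 / r <= e / 256]. *)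
Lemma split_ratio (R : realFieldType) (e r q rho : R) :
  0 <= e <= 1 -> 0 < r -> 256 <= e * r -> 0 <= rho -> rho <= e / 64 -> r <= 2 * q + 1 ->
  (1 + e / 8) / 2 / (1 - 2 * rho) ^+ 2 <= q / r * (1 + e).
Proof.
move=> /andP[e0 e1] r0 er rho0 rho_e hq.
have q2 : 1 - e / 16 <= (1 - 2 * rho) ^+ 2 by nra.
rewrite ler_pdivrMr; last by apply: lt_le_trans q2; lra.
have x1 : (1 - e / 256) / 2 <= q / r by rewrite ler_pdivlMr //; lra.
have : (1 - e / 256) / 2 * (1 + e) * (1 - e / 16) <= q / r * (1 + e) * (1 - 2 * rho) ^+ 2.
  by apply: ler_pM => //; [nra|lra|apply: ler_wpM2r => //; lra].
apply: le_trans.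
have : 0 <= e * (1 - e) by nra.
have : 0 <= e * (e * (1 - e)) by nra.
nra.
Qed.

Lemma halving (R : realType) n k r1 r2 (a : R) (H : {set edge n}) :
  (0 < k)%N -> large_level k -> (2 ^ k <= r1 + r2 <= 2 ^ k.+1)%N ->
  (r1 <= r2 <= r1.+1)%N -> 16^-1 <= a <= 1 ->
  regular_bip (r1 + r2) H -> expanding a (r1 + r2) H ->
  let e : R := (k%:R ^+ 2)^-1 in
  let r : R := (r1 + r2)%:R in
  exists nu : {set edge n} -> R,
  [/\ is_distr nu,
    forall M, 0 < nu M -> [/\ M \subset H,
      regular_bip r1 M /\ expanding (a * (1 - e)) r1 M &
      regular_bip r2 (H :\: M) /\ expanding (a * (1 - e)) r2 (H :\: M)] &
    forall S1 S2 : {set edge n},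
      \sum_(M : {set edge n} | (S1 \subset M) && (S2 \subset H :\: M)) nu M <=
      (r1%:R / r * (1 + e)) ^+ #|S1| * (r2%:R / r * (1 + e)) ^+ #|S2|].
Proof.
move=> k0 big /andP[rk1 rk2] r12 /andP[a16 a1] reg expd e r.
pose K : R := k%:R; pose P : R := 2 ^+ k.
have K1 : 1 <= K by rewrite ler1n.
have eK : K ^+ 2 * e = 1 by rewrite mulfV // expf_eq0 /= pnatr_eq0 -lt0n k0.
have e0 : 0 < e by rewrite invr_gt0 exprn_gt0 // (lt_le_trans ltr01).
have e1 : e <= 1 by rewrite invf_le1 ?exprn_ege1 // exprn_gt0 // (lt_le_trans ltr01).
have bigR : 2 ^+ 17 * K ^+ 4 * (2 * K + 8) <= P.
  by rewrite /K /P -!natrX -natrM -[2 * _]natrM -natrD -natrM ler_nat.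
have rD : (r1 + r2)%:R = r by [].
have rP1 : P <= r by rewrite /P -natrX ler_nat.
have rP2 : r <= 2 * P by rewrite /P -exprS -natrX ler_nat.
have rK4 : 2 ^+ 17 * K ^+ 4 * (2 * K + 8) <= r by exact: le_trans bigR rP1.
have P0 : 0 < P by rewrite exprn_gt0.
have r0 : 0 < r by exact: lt_le_trans P0 rP1.
have r_gt0 : (0 < r1 + r2)%N by rewrite -(ltr_nat R).
have rE : r = r1%:R + r2%:R by rewrite /r natrD.
clearbody e r.
have a0 : 0 <= a by apply: le_trans a16; rewrite invr_ge0.
have rK2 : 256 * K ^+ 2 <= r.
  apply: le_trans rK4; have : 1 <= K ^+ 2 by exact: exprn_ege1.
  rewrite (_ : K ^+ 4 = (K ^+ 2) ^+ 2); last by rewrite -exprM.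
  set q := K ^+ 2 => q1; have : 1 <= (2 ^+ 9 : R) by rewrite exprn_ege1 // ler1n.
  rewrite (_ : 2 ^+ 17 = 256 * 2 ^+ 9 :> R); last by rewrite -!natrX -natrM.
  set s := 2 ^+ 9 => s1.
  have : q <= q ^+ 2 by rewrite ler_eXnr.
  have h : 1 <= s * (2 * K + 8) by nra.
  set q2 := q ^+ 2 => qq2.
  have : q2 <= q2 * (s * (2 * K + 8)) by rewrite ler_peMr //; lra.
  lra.
have er : 256 <= e * r by have : 0 <= e * (r - 256 * K ^+ 2); [rewrite mulr_ge0 ?subr_ge0 // ltW|lra].
pose eta := e / 8.
have eta01 : 0 < eta <= 2^-1 by rewrite /eta; apply/andP; split; lra.
have rhoE : (8 * r ^+ 2)^-1 * (8 * r ^+ 2) = 1 :> R.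
  by rewrite mulVf // gt_eqF // mulr_gt0 // exprn_gt0.
have tail : 4 * expR (- ((eta / 2) ^+ 2 / 32) * (a * (r1 + r2)%:R)) <=
    (8 * (r1 + r2)%:R ^+ 2)^-1 / 2 :> R.
  rewrite rD.
  (* With [eta = 1 / (8 k^2)] and [a >= 1/16] the constants multiply to [2^17 k^4], as in
     [large_level]. The exponent [2 k + 8] yields [1 / (64 * 4^k)], at most [1 / (16 r^2)] because
     [r <= 2^(k+1)]. *)
  have X : (2 * k + 8)%:R <= (eta / 2) ^+ 2 / 32 * (a * r).
    have ar : 16^-1 * (2 ^+ 17 * K ^+ 4 * (2 * K + 8)) <= a * r.
      apply: ler_pM => //; rewrite ?invr_ge0 ?mulr_ge0 ?exprn_ge0 //; lra.
    have : 0 <= (eta / 2) ^+ 2 / 32 by rewrite divr_ge0 // sqr_ge0.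
    move=> /ler_wpM2l /(_ _ _ ar); apply: le_trans.
    rewrite le_eqVlt; apply/orP; left; apply/eqP.
    rewrite natrD natrM -/K.
    transitivity ((K ^+ 2 * e) ^+ 2 * (2 * K + 8)); first by rewrite eK; ring.
    by rewrite /eta; field.
  have Y : expR (- ((eta / 2) ^+ 2 / 32) * (a * r)) <= 2^-1 ^+ (2 * k + 8).
    by apply: le_trans (expR_halfN _ _); rewrite ler_expR mulNr lerN2.
  apply: (@le_trans _ _ (4 * 2^-1 ^+ (2 * k + 8))); first exact: ler_wpM2l.
  rewrite exprD mulnC exprM exprVn -/P.
  rewrite (_ : 4 * _ = (64 * P ^+ 2)^-1); last by field; rewrite gt_eqF.
  rewrite -invfM lef_pV2 ?posrE ?mulr_gt0 ?exprn_gt0 //; nra.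
have cut_large : 1 <= eta / 2 * (a * (r1 + r2)%:R).
  rewrite rD /eta; nra.
have [nu [nud nuM nuS]] := split_distr r_gt0 reg expd a0 eta01 tail cut_large erefl r12.
have R1 : r1%:R <= r2%:R :> R by rewrite ler_nat; case/andP: r12.
have R2 : r2%:R <= r1%:R + 1 :> R by rewrite natr1 ler_nat; case/andP: r12.
exists nu; split => //.
- move=> M /nuM[MH regM E1 E2].
  (* The loss [e] covers both [2 eta = e / 4] and the rounding of [r / 2], since [e r >= 256]. *)
  have grow (q : R) : 2 * q <= r + 1 -> 0 <= q -> forall T : {set 'I_n + 'I_n}, (#|T| <= n)%N ->
      a * (1 - e) * q * #|T|%:R <= (1 - 2 * eta) / 2 * #|bd H T|%:R.
    move=> q2 q0 T Tn; have := expd T Tn; rewrite rD => h.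
    have g0 : 0 <= (1 - 2 * eta) / 2 by rewrite /eta; lra.
    apply: le_trans (ler_wpM2l g0 h).
    rewrite [leRHS]mulrA; apply: ler_wpM2r => //.
    rewrite [leRHS]mulrCA -mulrA; apply: ler_wpM2l => //.
    rewrite /eta; nra.
  split => //; split => //.
  + by move=> T Tn; apply: le_trans (E1 T Tn); apply: grow => //; lra.
  + exact: regular_bipD MH reg regM.
  + by move=> T Tn; apply: le_trans (E2 T Tn); apply: grow => //; lra.
- move=> S1 S2; apply: le_trans (nuS S1 S2) _; rewrite exprD rD.
  set rho := (8 * _)^-1; rewrite -/rho in rhoE.
  have rho0 : 0 < rho by rewrite invr_gt0 mulr_gt0 // exprn_gt0.
  have r1' : 1 <= r by apply: le_trans rP1; rewrite /P exprn_ege1 // ler1n.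
  have rho_e : rho <= e / 64.
    have rho_er : rho * (8 * r * (e * r)) = e.
      by transitivity (rho * (8 * r ^+ 2) * e); [ring|rewrite rhoE mul1r].
    have er8 : 64 <= 8 * r * (e * r).
      have : 1 * 256 <= r * (e * r) by apply: ler_pM.
      lra.
    have := ler_wpM2l (ltW rho0) er8; rewrite rho_er; lra.
  have qq (q : R) : r <= 2 * q + 1 -> (1 + eta) / 2 / (1 - 2 * rho) ^+ 2 <= q / r * (1 + e).
    by move=> hq; apply: split_ratio => //; rewrite ?(ltW e0) ?(ltW rho0).
  have q10 := qq r1%:R ltac:(lra); have q20 := qq r2%:R ltac:(lra).
  have base0 : 0 <= (1 + eta) / 2 / (1 - 2 * rho) ^+ 2.
    by rewrite divr_ge0 ?sqr_ge0 //; rewrite /eta; lra.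
  have pow (x y : R) m : 0 <= x -> x <= y -> x ^+ m <= y ^+ m.
    by move=> x0 xy; apply: lerXn2r; rewrite ?nnegrE ?(le_trans x0).
  by apply: ler_pM; rewrite ?exprn_ge0 // pow.
Qed.

(* The telescoping (k+1)/(k+2) * (1 - 1/(k+1)^2) = k/(k+1) absorbs the losses of
   all the halvings. *)
Definition level_expansion (R : realType) (k : nat) : R := k%:R / k.+1%:R / 8.
Definition level_spread (R : realType) (k0 k : nat) : R := 2 ^+ (k0 + 2) * (k%:R / k.+1%:R).

(** Induction on the level [k]: split by [halving], factorise both halves, combine. The upper end
    [2 ^ k.+1] is allowed because the larger half of an odd [r] can reach it. *)
Lemma spread_factorisation_ex (R : realType) (k0 : nat) :
  (0 < k0)%N -> (forall k, (k0 <= k)%N -> large_level k) ->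
  forall k n r (H : {set edge n}), (k0 <= k)%N -> (2 ^ k <= r <= 2 ^ k.+1)%N ->
  regular_bip r H -> expanding (level_expansion R k) r H ->
  exists kappa, @spread_factorisation R n r H (level_spread R k0 k / r%:R) kappa.
Proof.
move=> k00 large; elim=> [|k IH] n r H; first by lia.
move=> k0k /andP[rk1 rk2] reg expd.
have [k0k'|kk0] := leqP k0 k; last first.
  (* At the bottom [r <= 2^(k0+1)] and [k0 / (k0 + 1) >= 1/2], so the factor [2^(k0+2)] makes the
     claimed spread at least 1. *)
  have kE : k.+1 = k0 by lia.
  apply: spread_factorisation_ge1 => //.
  have r0 : (0 < r)%N by apply: leq_trans rk1; rewrite expn_gt0.
  rewrite ler_pdivlMr ?ltr0n // mul1r /level_spread kE.
  apply: (@le_trans _ _ (2 ^+ k0.+1)); first by rewrite -natrX ler_nat -kE.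
  rewrite addn2 [2 ^+ k0.+2]exprSr -mulrA; rewrite ler_peMr ?exprn_ge0 //.
  rewrite mulrA ler_pdivlMr ?ltr0n // mul1r -natrM ler_nat; lia.
pose r1 := r./2; pose r2 := (r - r./2)%N.
have r12 : (r1 <= r2 <= r1.+1)%N by rewrite /r1 /r2; lia.
have rE : r = (r1 + r2)%N by rewrite /r1 /r2; lia.
have pk : (2 ^ k.+2 = 2 ^ k.+1 + 2 ^ k.+1)%N by rewrite expnS; lia.
have pk' : (2 ^ k.+1 = 2 ^ k + 2 ^ k)%N by rewrite expnS; lia.
have r1k : (2 ^ k <= r1 <= 2 ^ k.+1)%N by lia.
have r2k : (2 ^ k <= r2 <= 2 ^ k.+1)%N by lia.
have pk0 : (0 < 2 ^ k)%N by rewrite expn_gt0.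
move: (r1) (r2) r12 rE r1k r2k => {}r1 {}r2 r12 rE r1k r2k; subst r.
pose x : R := k%:R.
have x1 : 1 <= x by rewrite ler1n; lia.
have xS : k.+1%:R = x + 1 :> R by rewrite -natr1.
have xSS : k.+2%:R = x + 2 :> R by rewrite -natr1 xS; ring.
have a01 : 16^-1 <= level_expansion R k.+1 <= 1.
  rewrite /level_expansion xS xSS.
  have : 2^-1 <= (x + 1) / (x + 2) by rewrite ler_pdivlMr; lra.
  have : (x + 1) / (x + 2) <= 1 by rewrite ler_pdivrMr; lra.
  by move=> h1 h2; apply/andP; split; lra.
have rk12 : (2 ^ k.+1 <= r1 + r2 <= 2 ^ k.+2)%N by rewrite rk1 rk2.
have [nu [nud nuM nuS]] := halving (ltn0Sn k) (large _ k0k) rk12 r12 a01 reg expd.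
have aE : level_expansion R k.+1 * (1 - (k.+1%:R ^+ 2)^-1) = level_expansion R k.
  by rewrite /level_expansion xS xSS; field; rewrite -/x !gt_eqF //; lra.
rewrite aE in nuM.
set e : R := (k.+1%:R ^+ 2)^-1 in nuS.
have e0 : 0 <= e by rewrite invr_ge0 exprn_ge0.
have L0 : 0 <= level_spread R k0 k by rewrite mulr_ge0 ?exprn_ge0 ?divr_ge0.
(* With [m = x + 1] this reads [(m - 1) (m + 1) (m^2 + 1) = m^4 - 1 <= m^4]. *)
have LL : level_spread R k0 k * (1 + e) <= level_spread R k0 k.+1.
  rewrite /level_spread -mulrA; apply: ler_wpM2l; first exact: exprn_ge0.
  rewrite /e xS xSS -/x ler_pdivlMr; last lra.
  rewrite (_ : x / (x + 1) * (1 + ((x + 1) ^+ 2)^-1) * (x + 2) =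
    (x * (x + 2) * ((x + 1) ^+ 2 + 1)) / (x + 1) ^+ 3); last by field; rewrite -/x gt_eqF //; lra.
  rewrite ler_pdivrMr ?exprn_gt0 //; last lra.
  nra.
have R10 : 0 < r1%:R :> R by rewrite ltr0n; lia.
have R20 : 0 < r2%:R :> R by rewrite ltr0n; lia.
apply: (@spread_factorisation_combine R n r1 r2 H (level_spread R k0 k / r1%:R) (level_spread R k0 k / r2%:R)
  (r1%:R / (r1 + r2)%:R * (1 + e)) (r2%:R / (r1 + r2)%:R * (1 + e)) _ nu) => //.
- by rewrite divr_ge0.
- by rewrite divr_ge0.
- by rewrite mulr_ge0 ?divr_ge0 //; lra.
- by rewrite mulr_ge0 ?divr_ge0 //; lra.
- rewrite (_ : _ * _ = level_spread R k0 k * (1 + e) / (r1 + r2)%:R).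
    by rewrite ler_pM2r // invr_gt0 natrD addr_gt0.
  by rewrite natrD; field; rewrite !gt_eqF // addr_gt0.
- rewrite (_ : _ * _ = level_spread R k0 k * (1 + e) / (r1 + r2)%:R).
    by rewrite ler_pM2r // invr_gt0 natrD addr_gt0.
  by rewrite natrD; field; rewrite !gt_eqF // addr_gt0.
- by move=> M /nuM[].
- by move=> M /nuM[_ [regM expM] _]; exact: IH.
- by move=> M /nuM[_ _ [regM expM]]; exact: IH.
Qed.

(** * Expansion of the random graph *)

Lemma exists_subset_card (T : finType) (B : {set T}) m : (m <= #|B|)%N ->
  exists2 A : {set T}, A \subset B & #|A| = m.
Proof.
rewrite -bin_gt0 -cards_draws card_gt0 => /set0Pn[A].
by rewrite inE => /andP[AB /eqP Am]; exists A.
Qed.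

Lemma exists_superset_card (T : finType) (B : {set T}) m : (#|B| <= m <= #|T|)%N ->
  exists2 A : {set T}, B \subset A & #|A| = m.
Proof.
move=> /andP[Bm mT]; have cB := cardsC B.
have [|D DB cD] := @exists_subset_card _ (~: B) (m - #|B|); first by lia.
exists (B :|: D); first exact: subsetUl.
rewrite cardsU cD (_ : B :&: D = set0) ?cards0; first by lia.
by apply/eqP; rewrite setI_eq0 disjoint_sym disjoints_subset.
Qed.

Lemma exp6_step m : (64 <= m)%N -> (m.+1 ^ 6 <= 2 * m ^ 6)%N.
Proof.
move=> m64; rewrite (expnM m.+1 2 3) (expnM m 2 3).
have : (10 * m.+1 ^ 2 <= 11 * m ^ 2)%N by nia.
move: (m.+1 ^ 2)%N (m ^ 2)%N => u v uv.
have : ((10 * u) ^ 3 <= (11 * v) ^ 3)%N by rewrite leq_exp2r.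
rewrite !expnMn.
move: (u ^ 3)%N (v ^ 3)%N => {uv}u {}v.
by rewrite (_ : 10 ^ 3 = 1000)%N // (_ : 11 ^ 3 = 1331)%N //; lia.
Qed.

Lemma exp6_le_exp2 k : (64 <= k)%N -> (2 ^ 17 * k ^ 6 <= 2 ^ k)%N.
Proof.
move=> k64; rewrite -(subnKC k64); elim: (k - 64)%N => [|j IH].
  rewrite addn0; apply: (@leq_trans (2 ^ (17 + 6 * 6))); last by rewrite leq_exp2l.
  by rewrite expnD leq_mul2l (expnM 2 6 6) leq_exp2r // orbT.
rewrite addnS (expnS 2 (64 + j)); apply: leq_trans (leq_mul (leqnn 2) IH).
rewrite mulnCA leq_mul2l; apply/orP; right; apply: exp6_step; exact: leq_addr.
Qed.

Lemma large_level_eventually k : (64 <= k)%N -> large_level k.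
Proof.
move=> k64; rewrite /large_level; apply: leq_trans (exp6_le_exp2 k64).
rewrite -mulnA leq_mul2l; apply/orP; right.
rewrite (expnD k 4 2) leq_mul2l; apply/orP; right; nia.
Qed.

Section RandomExpansion.
Variables (R : realType) (n : nat).
Implicit Types (H : {set edge n}) (X Z : {set 'I_n}) (T : {set 'I_n + 'I_n}).

Lemma card_bd H T (X := [set x | inl x \in T]) (Z := [set z | inr z \in T]) :
  #|bd H T| = (nb_edges H X (~: Z) + nb_edges H (~: X) Z)%N.
Proof.
rewrite !nb_edges_card -cardsUI [X in (_ + X)%N]eq_card0 => [|e]; last first.
  by rewrite !inE; case: (inl _ \in T); rewrite ?andbF ?andbT.
rewrite addn0; apply: eq_card => e; rewrite !inE.
by case: (e \in H); case: (inl _ \in T); case: (inr _ \in T).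
Qed.

Lemma card_sides T :
  #|T| = (#|[set x | inl x \in T]| + #|[set z | inr z \in T]|)%N.
Proof.
rewrite -!sum1_card big_mkcond big_sumType /=; congr addn;
  by rewrite [RHS]big_mkcond; apply: eq_bigr => x _; rewrite inE.
Qed.

Lemma nb_edgesS H X X' Z Z' : X \subset X' -> Z \subset Z' -> (nb_edges H X Z <= nb_edges H X' Z')%N.
Proof.
move=> XX ZZ; rewrite !nb_edges_card; apply: subset_leq_card; apply/subsetP => e.
by rewrite !inE => /andP[-> /andP[/(subsetP XX) -> /(subsetP ZZ) ->]].
Qed.

(* [a >= b] are the sizes of the two sides of a poorly expanding set and [E]
   counts the edges between them. *)
Lemma poor_expansion (N r a b E delta delta' : R) :
  0 < r -> 0 <= b <= a -> a + b <= N -> delta <= 2^-1 ->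
  E <= r * b -> 7 / 8 * (r * (a + b)) < 2 * E ->
  (delta' * N <= b -> delta' * N <= N - a ->
    (1 - delta) * (r / N) * (N - a) * b <= r * b - E) ->
  a <= 2 * (delta' * N) /\ 3 / 4 * (r * a) <= E.
Proof.
move=> r0 /andP[b0 ba] abN d Eb Elow dense.
have ab : 7 * a <= 9 * b by rewrite -(ler_pM2l r0); lra.
(* If [b] is below the density threshold, [7 a <= 9 b] gives both conclusions; otherwise density
   leads to a contradiction. *)
have [|bd'] := lerP (delta' * N) b; last by split; nra.
move=> bd'; have {}dense := dense bd' ltac:(lra).
have b_gt0 : 0 < b.
  rewrite lt_def b0 andbT; apply: contraTneq Elow => b00.
  by rewrite -leNgt; rewrite b00 in ab Eb *; nra.
have N0 : 0 < N by lra.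
have aN : (1 - delta) * (r / N) * (N - a) * b >= 2^-1 * (r * b) * (1 - a / N).
  rewrite (_ : (1 - delta) * (r / N) * (N - a) * b = (1 - delta) * (r * b) * (1 - a / N)).
    apply: ler_wpM2r; last by apply: ler_wpM2r; [nra|lra].
    by rewrite subr_ge0 ler_pdivrMr // mul1r; lra.
  by field; rewrite gt_eqF.
have rb : r * b <= r * a by rewrite ler_pM2l.
have rb0 : 0 < r * b by exact: mulr_gt0.
set q := a / N in aN; have qN : a = q * N by rewrite /q divfK // gt_eqF.
(* The failure of expansion leaves at most [r b / 8] edges from the smaller side to outside the
   larger, while density gives at least [r b (1 - q) / 2]. But [a + b <= N] and [7 a <= 9 b] force
   [q <= 9/16]. *)
have : 3 / 4 <= q.
  rewrite leNgt; apply/negP => ql; nra.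
move=> q34; exfalso; nra.
Qed.

(** By [poor_expansion] the two sides of a poorly expanding set are small and span many edges.
    Padding the smaller side to equal size only adds edges and leaves one size parameter for the
    union bound. *)
Lemma dense_pair r H (delta delta' : R) : (0 < r)%N -> delta <= 2^-1 ->
  regular_bip r H -> dense_bip delta delta' (r%:R / n%:R) H ->
  ~ expanding (8^-1 : R) r H ->
  exists X Z, [/\ #|X| = #|Z|, (0 < #|X|)%N, #|X|%:R <= 2 * (delta' * n%:R) &
    (#|X| * r./2 <= nb_edges H X Z)%N].
Proof.
move=> r_gt0 d reg dense nexp.
have [T Tn Tlow] : exists2 T : {set 'I_n + 'I_n}, (#|T| <= n)%N & #|bd H T|%:R < 8^-1 * r%:R * #|T|%:R :> R.
  apply: contrapT => h; apply: nexp => T Tn; rewrite leNgt; apply/negP => lt.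
  by apply: h; exists T.
have [hL hR] := (regular_bipP _ _).1 reg.
move: Tlow Tn; rewrite card_bd card_sides.
set X := [set x | _]; set Z := [set z | _] => Tlow Tn.
have degX : (#|X| * r = nb_edges H X Z + nb_edges H X (~: Z))%N.
  by rewrite -sum_nat_const -(sum_degL H X Z); apply: eq_bigr => x _; rewrite hL.
have degZ : (#|Z| * r = nb_edges H X Z + nb_edges H (~: X) Z)%N.
  by rewrite -sum_nat_const -(sum_degR H X Z); apply: eq_bigr => x _; rewrite hR.
have cX : #|~: X|%:R = n%:R - #|X|%:R :> R.
  by apply/eqP; rewrite eq_sym subr_eq -natrD addnC cardsC card_ord.
have cZ : #|~: Z|%:R = n%:R - #|Z|%:R :> R.
  by apply/eqP; rewrite eq_sym subr_eq -natrD addnC cardsC card_ord.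
have dX := dense (~: X) Z; have dZ := dense X (~: Z).
rewrite -nb_edges_card cX in dX; rewrite -nb_edges_card cZ in dZ.
pose E : R := (nb_edges H X Z)%:R.
have r0 : 0 < r%:R :> R by rewrite ltr0n.
move/(congr1 (fun m => m%:R : R)): (degX); move/(congr1 (fun m => m%:R : R)): (degZ).
rewrite !natrM !natrD -/E in Tlow * => degZR degXR.
have sn : #|X|%:R + #|Z|%:R <= n%:R :> R by rewrite -natrD ler_nat.
have nX0 : 0 <= (nb_edges H X (~: Z))%:R :> R by [].
have nZ0 : 0 <= (nb_edges H (~: X) Z)%:R :> R by [].
have half_r : (2 * r./2 <= r)%N by rewrite mul2n -[leqRHS]odd_double_half leq_addl.
have fin (m : nat) : 3 / 4 * (r%:R * m%:R) <= E -> (m * r./2 <= nb_edges H X Z)%N.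
  move=> h; rewrite -(ler_nat R); apply: le_trans h; rewrite natrM.
  rewrite mulrA [leLHS]mulrC; apply: ler_wpM2r => //.
  have : 2 * (r./2)%:R <= r%:R :> R by rewrite -natrM ler_nat.
  lra.
have pos (m : nat) : (#|X| <= m)%N -> (#|Z| <= m)%N -> (0 < m)%N.
  move=> Xm Zm; rewrite lt0n; apply: contraTneq Tlow => m0.
  move: Xm Zm; rewrite m0 !leqn0 => /eqP -> /eqP ->.
  by rewrite addr0 mulr0 -leNgt addr_ge0.
have [ZX|XZ] := leqP #|Z| #|X|.
  have [|||||||sX lX] := @poor_expansion n%:R r%:R #|X|%:R #|Z|%:R E delta delta' => //.
  - by rewrite ler0n ler_nat.
  - lra.
  - lra.
  - by move=> h1 h2; have := dX h2 h1; lra.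
  have [|Z' ZZ' cZ'] := @exists_superset_card _ Z #|X|; first by rewrite ZX max_card.
  exists X, Z'; split => //; first exact: pos.
  by apply: leq_trans (fin _ lX) _; exact: nb_edgesS.
have [|||||||sX lX] := @poor_expansion n%:R r%:R #|Z|%:R #|X|%:R E delta delta' => //.
- by rewrite ler0n ler_nat ltnW.
- lra.
- lra.
- lra.
- by move=> h1 h2; have := dZ h1 h2; lra.
have [|X' XX' cX'] := @exists_superset_card _ X #|Z|; first by rewrite (ltnW XZ) max_card.
exists X', Z; rewrite cX'; split => //; first by apply: pos => //; exact: ltnW.
by apply: leq_trans (fin _ lX) _; exact: nb_edgesS.
Qed.

End RandomExpansion.

Lemma leq_half3 m : (2 <= m)%N -> (m <= 3 * m./2)%N.
Proof. lia. Qed.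

(** * First moment bound for small dense pairs *)

Section UnionBound.
Variable R : realType.
Local Notation c := (expR 1 : R).

Lemma expR1_ge1 : 1 <= c.
Proof. by have := expR_ge1Dx (1 : R); lra. Qed.

(** One term of the exponential series at [m] is at most its sum. *)
Lemma expn_le_fact m : m%:R ^+ m <= c ^+ m * m`!%:R.
Proof.
case: m => [|m]; first by rewrite !expr0 fact0 mulr1.
have := @expR_ge1Dxn R m.+1%:R m (ler0n _ _).
rewrite -{2}[m.+1%:R]mulr1 expRM_natl => h.
rewrite -ler_pdivrMr ?ltr0n ?fact_gt0 //; lra.
Qed.

Lemma ffact_le_expn N m : (N ^_ m <= N ^ m)%N.
Proof.
by elim: m N => [|m IH] N //; rewrite ffactnSr expnSr leq_mul ?leq_subr.
Qed.

Lemma bin_le N m : (0 < m)%N -> ('C(N, m))%:R <= (c * N%:R / m%:R) ^+ m.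
Proof.
move=> m0; have f0 : 0 < m`!%:R :> R by rewrite ltr0n fact_gt0.
have m0R : 0 < m%:R :> R by rewrite ltr0n.
rewrite expr_div_n ler_pdivlMr ?exprn_gt0 //.
apply: le_trans (ler_wpM2l (ler0n _ _) (expn_le_fact m)) _.
rewrite mulrCA exprMn; apply: ler_wpM2l; first by rewrite exprn_ge0 ?expR_ge0.
by rewrite -natrM bin_ffact -natrX ler_nat ffact_le_expn.
Qed.

Lemma bernoulli_ge (x : R) m : 0 <= x -> 1 + m%:R * x <= (1 + x) ^+ m.
Proof.
move=> x0; elim: m => [|m IH]; first by rewrite mul0r addr0.
rewrite exprS -natr1; have : 0 <= m%:R :> R by [].
move: IH; set p := (1 + x) ^+ m; set M := m%:R => IH M0.
have : (1 + x) * (1 + M * x) <= (1 + x) * p by apply: ler_wpM2l => //; lra.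
have : 0 <= M * x * x by rewrite !mulr_ge0.
lra.
Qed.

(** Bernoulli for the reciprocal: [(n / a)^a >= 1 + n - a >= n / 2]. *)
Lemma ratio_expn_le (a n : nat) : (0 < a)%N -> (2 * a <= n)%N ->
  (a%:R / n%:R) ^+ a <= 2 / n%:R :> R.
Proof.
move=> a0 an.
have a0R : 0 < a%:R :> R by rewrite ltr0n.
have anR : 2 * a%:R <= n%:R :> R by rewrite -natrM ler_nat.
have n0R : 0 < n%:R :> R by lra.
have y0 : 0 < a%:R / n%:R :> R by rewrite divr_gt0.
rewrite -[leLHS]invrK -[leRHS]invrK lef_pV2 ?posrE ?invr_gt0 ?exprn_gt0 ?divr_gt0 //.
rewrite -exprVn !invf_div.
have := @bernoulli_ge (n%:R / a%:R - 1) a.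
rewrite addrCA subrr addr0 subr_ge0 ler_pdivlMr // mul1r => /(_ ltac:(lra)).
apply: le_trans; rewrite mulrBr mulrCA divff ?gt_eqF // !mulr1; lra.
Qed.

(** The smallness of [y] says that [z = 3 c C y] satisfies [z^2 <= y], so [z^26 <= y^13]. Two powers
    of [y] cancel the denominator and a third absorbs [c^2]. *)
Lemma term_le (C y : R) m : 1 <= C -> 0 < y -> 9 * c ^+ 2 * C ^+ 2 * y <= 1 -> (26 <= m)%N ->
  (c / y) ^+ 2 * (3 * c * C * y) ^+ m <= y ^+ 10.
Proof.
move=> C1 y0 cy m26; have c1 := expR1_ge1.
have C2 : 1 <= C ^+ 2 by exact: exprn_ege1.
have c2 : 1 <= c ^+ 2 by exact: exprn_ege1.
have cC2 : 1 <= c ^+ 2 * C ^+ 2 by exact: mulr_ege1 (exprn_ege1 _ c1) (exprn_ege1 _ C1).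
have c2y : c ^+ 2 * y <= 1.
  have : c ^+ 2 * y <= c ^+ 2 * y * C ^+ 2 by rewrite ler_peMr // mulr_ge0 ?sqr_ge0 // ltW.
  have : 0 <= c ^+ 2 * y * C ^+ 2 := mulr_ge0 (mulr_ge0 (sqr_ge0 _) (ltW y0)) (sqr_ge0 _).
  lra.
set z := 3 * c * C * y.
have z0 : 0 <= z by rewrite /z !mulr_ge0 ?expR_ge0 //; lra.
have zE : z ^+ 2 = 9 * c ^+ 2 * C ^+ 2 * y * y by rewrite /z; ring.
have z2 : z ^+ 2 <= y by rewrite zE; apply: ler_piMl => //; exact: ltW.
have y1 : y <= 1.
  have : y <= c ^+ 2 * y by rewrite ler_peMl // ltW.
  lra.
have z1 : z <= 1 by rewrite -(@ler_pXn2r _ 2) ?nnegrE ?ler01 // expr1n; lra.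
have zm : z ^+ m <= y ^+ 13.
  apply: (@le_trans _ _ (z ^+ 26)); first exact: ler_wiXn2l.
  rewrite (exprM z 2 13); apply: lerXn2r; rewrite ?nnegrE ?sqr_ge0 //; exact: ltW.
apply: le_trans (ler_wpM2l (sqr_ge0 _) zm) _.
rewrite (_ : (c / y) ^+ 2 * y ^+ 13 = c ^+ 2 * y * y ^+ 10); last first.
  by field; rewrite gt_eqF.
by apply: ler_piMl => //; rewrite exprn_ge0 // ltW.
Qed.

Section Random.
Variables (n r : nat) (mu : {set edge n} -> R) (C delta delta' : R).
Hypothesis mu_distr : is_distr mu.
Hypothesis mu_supp : forall H, 0 < mu H ->
  regular_bip r H /\ dense_bip delta delta' (r%:R / n%:R) H.
Hypothesis mu_spread : spread mu (C * r%:R / n%:R).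
Hypothesis C1 : 1 <= C.
Hypothesis delta_le : delta <= 2^-1.
Hypothesis delta'_le : 18 * c ^+ 2 * C ^+ 2 * delta' <= 1.
Hypothesis r_ge : (52 <= r)%N.
Hypothesis n_ge : (1024 < n)%N.

Let small (a : 'I_n.+1) : bool := (0 < a)%N && (a%:R <= 2 * (delta' * n%:R)).
Let sized (a : nat) : {set {set 'I_n}} := [set X : {set 'I_n} | #|X| == a].
Let subsets (X Z : {set 'I_n}) (m : nat) : {set {set edge n}} :=
  [set S : {set edge n} | S \subset setX X Z & #|S| == m].
(** Counts witnesses: pairs as in [dense_pair] together with a choice of [a * r./2] of their edges,
    so that spreadness applies to each fixed [S]. *)
Let dense_count (H : {set edge n}) : R :=
  \sum_(a < n.+1 | small a) \sum_(X in sized a) \sum_(Z in sized a)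
    \sum_(S in subsets X Z (a * r./2)) (S \subset H)%:R.

Lemma dense_count_ge0 H : 0 <= dense_count H.
Proof. by do 4! (apply: sumr_ge0 => ? _). Qed.

Lemma dense_count_ge1 H : regular_bip r H -> dense_bip delta delta' (r%:R / n%:R) H ->
  ~ expanding (8^-1 : R) r H -> 1 <= dense_count H.
Proof.
move=> reg dense nexp.
have r0 : (0 < r)%N by apply: leq_trans r_ge.
have [X [Z [XZ X0 Xs]]] := dense_pair r0 delta_le reg dense nexp.
rewrite nb_edges_card => /exists_subset_card[S SE cS].
have Xn : (#|X| < n.+1)%N by rewrite ltnS -[leqRHS]card_ord max_card.
rewrite /dense_count (bigD1 (Ordinal Xn)) /=; last by rewrite /small X0.
rewrite (bigD1 X) ?inE //= (bigD1 Z) ?inE /= -?XZ //.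
have SXZ : S \in subsets X Z (#|X| * r./2).
  rewrite inE cS eqxx andbT; apply/subsetP => e /(subsetP SE).
  by rewrite !inE => /andP[].
rewrite (bigD1 S) //= (_ : S \subset H) /=; last first.
  by apply/subsetP => e /(subsetP SE); rewrite inE => /andP[].
by rewrite -!addrA lerDl !addr_ge0 //; do ?(apply: sumr_ge0 => ? _); exact: ler0n.
Qed.

(** With [y = a / n], the binomial bounds give the [a]-th power of the expression in [term_le], the
    3 there coming from [r <= 3 * r./2]. Then [(y^10)^a = (y^a)^10], and [ratio_expn_le] applies. *)
Lemma small_term (a : 'I_n.+1) : small a ->
  ('C(n, a))%:R * ('C(n, a))%:R * (('C(a * a, a * r./2))%:R * (C * r%:R / n%:R) ^+ (a * r./2)) <=
  (2 / n%:R) ^+ 10 :> R.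
Proof.
move=> /andP[a0 as_].
have n0 : 0 < n%:R :> R by rewrite ltr0n; exact: ltn_trans n_ge.
have a0R : 0 < a%:R :> R by rewrite ltr0n.
set y : R := a%:R / n%:R; have y0 : 0 < y by rewrite divr_gt0.
have c1 := expR1_ge1.
have cC0 : 0 <= 9 * c ^+ 2 * C ^+ 2.
  by apply: mulr_ge0 (sqr_ge0 _); apply: mulr_ge0 (sqr_ge0 _).
have cy : 9 * c ^+ 2 * C ^+ 2 * y <= 1.
  have y2 : y <= 2 * delta' by rewrite /y ler_pdivrMr //; lra.
  apply: le_trans (ler_wpM2l cC0 y2) _.
  apply: le_trans delta'_le; rewrite le_eqVlt; apply/orP; left; apply/eqP.
  by move: (expR 1) => c'; ring.
have y_half : 2 * y <= 1.
  have s1 : 1 <= c ^+ 2 * C ^+ 2 by exact: mulr_ege1 (exprn_ege1 _ c1) (exprn_ege1 _ C1).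
  have : y <= (c ^+ 2 * C ^+ 2) * y by rewrite ler_peMl // ltW.
  by move: cy; rewrite -[9 * _ * _]mulrA -[9 * _ * y]mulrA; lra.
have an : (2 * a <= n)%N.
  rewrite -(ler_nat R) natrM (_ : a%:R = y * n%:R); last by rewrite divfK ?gt_eqF.
  by have := ler_wpM2r (ltW n0) y_half; rewrite mul1r -mulrA.
have r'0 : (0 < r./2)%N by rewrite half_gt0; apply: leq_trans r_ge.
have r'R : r%:R <= 3 * (r./2)%:R :> R by rewrite -natrM ler_nat leq_half3 //; apply: leq_trans r_ge.
have r'0R : 0 < (r./2)%:R :> R by rewrite ltr0n.
have m0 : (0 < a * r./2)%N by rewrite muln_gt0 a0.
have q0 : 0 <= C * r%:R / n%:R.
  exact: divr_ge0 (mulr_ge0 (le_trans ler01 C1) (ler0n _ _)) (ler0n _ _).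
have cN0 (N m : nat) : 0 <= c * N%:R / m%:R.
  exact: divr_ge0 (mulr_ge0 (expR_ge0 _) (ler0n _ _)) (ler0n _ _).
have Cp : 0 <= C := le_trans ler01 C1.
have cCy0 : 0 <= c * C * y := mulr_ge0 (mulr_ge0 (expR_ge0 _) Cp) (ltW y0).
have z0 : 0 <= 3 * c * C * y by rewrite -!mulrA mulr_ge0 // mulrA.
have edges : ('C(a * a, a * r./2))%:R * (C * r%:R / n%:R) ^+ (a * r./2) <=
    ((3 * c * C * y) ^+ r./2) ^+ a :> R.
  apply: le_trans (ler_wpM2r (exprn_ge0 _ q0) (bin_le (a * a) m0)) _.
  rewrite -exprMn -exprM [(r./2 * a)%N]mulnC; apply: lerXn2r; rewrite ?nnegrE //.
    exact: mulr_ge0 (cN0 _ _) q0.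
  rewrite !natrM (_ : c * (a%:R * a%:R) / (a%:R * (r./2)%:R) * (C * r%:R / n%:R) =
    c * C * y * (r%:R / (r./2)%:R)); last first.
    by rewrite /y; field; rewrite !gt_eqF.
  rewrite (_ : 3 * c * C * y = c * C * y * 3); last by ring.
  by apply: ler_wpM2l => //; rewrite ler_pdivrMr.
have verts : ('C(n, a))%:R * ('C(n, a))%:R <= ((c / y) ^+ 2) ^+ a :> R.
  have -> : ((c / y) ^+ 2) ^+ a = (c * n%:R / a%:R) ^+ a * (c * n%:R / a%:R) ^+ a.
    by rewrite exprAC expr2 /y invf_div mulrA.
  by apply: ler_pM => //; exact: bin_le.
apply: (@le_trans _ _ (((c / y) ^+ 2) ^+ a * ((3 * c * C * y) ^+ r./2) ^+ a)).
  by apply: ler_pM => //; rewrite mulr_ge0 // exprn_ge0.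
rewrite -exprMn; apply: (@le_trans _ _ ((y ^+ 10) ^+ a)).
  apply: lerXn2r; rewrite ?nnegrE.
  - by rewrite mulr_ge0 ?sqr_ge0 ?exprn_ge0.
  - by rewrite exprn_ge0 // ltW.
  - by apply: term_le => //; rewrite -[26%N]/(52./2)%N half_leq.
rewrite exprAC; apply: lerXn2r; rewrite ?nnegrE.
- by rewrite exprn_ge0 // ltW.
- exact: divr_ge0.
- exact: ratio_expn_le.
Qed.

Lemma mean_dense_count : \sum_H mu H * dense_count H <= n%:R * (2 / n%:R) ^+ 10.
Proof.
have q0 : 0 <= C * r%:R / n%:R.
  exact: divr_ge0 (mulr_ge0 (le_trans ler01 C1) (ler0n _ _)) (ler0n _ _).
rewrite (_ : \sum_H _ = \sum_(a < n.+1 | small a) \sum_(X in sized a) \sum_(Z in sized a)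
    \sum_(S in subsets X Z (a * r./2)) \sum_(H : {set edge n} | S \subset H) mu H); last first.
  under eq_bigr do rewrite big_distrr.
  rewrite exchange_big; apply: eq_bigr => a _.
  under eq_bigr do rewrite big_distrr.
  rewrite exchange_big; apply: eq_bigr => X _.
  under eq_bigr do rewrite big_distrr.
  rewrite exchange_big; apply: eq_bigr => Z _.
  under eq_bigr do rewrite big_distrr.
  rewrite exchange_big; apply: eq_bigr => S _.
  rewrite [RHS]big_mkcond; apply: eq_bigr => H _ /=.
  by case: (S \subset H); rewrite ?mulr1 ?mulr0.
apply: (@le_trans _ _ (\sum_(a < n.+1 | small a) (2 / n%:R) ^+ 10)).
  apply: ler_sum => a sa; apply: le_trans (small_term sa).
  apply: (@le_trans _ _ (\sum_(X in sized a) \sum_(Z in sized a)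
    (('C(a * a, a * r./2))%:R * (C * r%:R / n%:R) ^+ (a * r./2)))).
    apply: ler_sum => X; rewrite inE => /eqP cX; apply: ler_sum => Z; rewrite inE => /eqP cZ.
    apply: (@le_trans _ _ (\sum_(S in subsets X Z (a * r./2)) (C * r%:R / n%:R) ^+ (a * r./2))).
      by apply: ler_sum => S; rewrite inE => /andP[_ /eqP <-]; exact: mu_spread.
    by rewrite sumr_const cards_draws cardsX cX cZ mulr_natl.
  by rewrite !sumr_const card_draws card_ord -mulrnA -[leLHS]mulr_natl natrM.
(* The size 0 is excluded, which leaves at most [n] terms. *)
rewrite big_mkcond big_ord_recl /= /small /= add0r.
apply: (@le_trans _ _ (\sum_(i < n) (2 / n%:R) ^+ 10)).
  apply: ler_sum => i _; case: ifP => // _; rewrite exprn_ge0 // divr_ge0 //.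
by rewrite sumr_const card_ord -[leLHS]mulr_natl.
Qed.

(** Markov: [dense_count] is at least 1 on every supported graph that fails to expand, so its mean
    bounds their probability. *)
Lemma random_expanding :
  1 - (n%:R ^+ 8)^-1 <
  \sum_(H in [set H | `[< regular_bip r H /\ expanding (8^-1 : R) r H >]]) mu H.
Proof.
have [mu0 mu1] := mu_distr.
set G := [set H | _].
have -> : \sum_(H in G) mu H = 1 - \sum_(H | H \notin G) mu H.
  by rewrite -mu1 [X in _ = X - _](bigID (mem G)) /= addrK.
rewrite ltrD2l ltrN2.
have n0 : 0 < n%:R :> R by rewrite ltr0n; exact: ltn_trans n_ge.
(* The bound equals [(1024 / n) n^-8], which is where [1024 < n] enters. *)
apply: (@le_lt_trans _ _ (n%:R * (2 / n%:R) ^+ 10)); last first.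
  rewrite (_ : _ * _ = 1024 / n%:R * (n%:R ^+ 8)^-1); last by field; rewrite gt_eqF.
  rewrite gtr_pMl ?invr_gt0 ?exprn_gt0 //.
  by rewrite ltr_pdivrMr // mul1r ltr_nat.
apply: le_trans mean_dense_count; rewrite big_mkcond; apply: ler_sum => H _.
case: ifP => [nG|_]; last by rewrite mulr_ge0 // dense_count_ge0.
have [->|mun0] := eqVneq (mu H) 0; first by rewrite mul0r.
have mupos : 0 < mu H by rewrite lt_def mun0 mu0.
have [reg dense] := mu_supp mupos.
rewrite ler_peMr // dense_count_ge1 // => expd.
by move: nG; rewrite inE => /asboolP; apply.
Qed.

End Random.
End UnionBound.

(** The event requires the union of the [S c] to lie in [H], at cost [q1 ^+ s]; given [H], the
    factorisation costs [q2 ^+ s]. Conditioning on [G] costs at most a factor 2. *)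
Lemma conditional_spread (R : realType) n r (mu : {set edge n} -> R)
    (G : {set {set edge n}}) (q1 q2 q : R) :
  is_distr mu -> spread mu q1 -> 1 <= 2 * \sum_(H in G) mu H ->
  0 <= q1 -> 0 <= q2 -> 2 * (q2 * q1) <= q ->
  (forall H, H \in G -> exists kappa, @spread_factorisation R n r H q2 kappa) ->
  exists kappa : {set edge n} -> {ffun 'I_r -> {set edge n}} -> R,
    (forall H, H \in G ->
       is_distr (kappa H) /\
       (forall F, 0 < kappa H F -> one_factorisation H F)) /\
    forall S : {ffun 'I_r -> {set edge n}},
      (\sum_(H in G) mu H *
         \sum_(F : {ffun 'I_r -> {set edge n}} | [forall c, S c \subset F c])
            kappa H F) / (\sum_(H in G) mu H)
      <= q ^+ (\sum_(c < r) #|S c|).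
Proof.
move=> [mu0 mu1] sp half q10 q20 qq ex.
have /choice[kappa kP] : forall H, exists kappa, H \in G -> @spread_factorisation R n r H q2 kappa.
  move=> H; have [/ex[k hk]|_] := boolP (H \in G); first by exists k.
  by exists (fun=> 0).
exists kappa; split=> [H HG|S].
  by have [? ? _] := kP H HG.
set p := \sum_(H in G) mu H in half *; have p0 : 0 < p by lra.
have q0 : 0 <= q by apply: le_trans qq; rewrite !mulr_ge0.
rewrite ler_pdivrMr //; set s := (\sum_(c < r) _)%N.
have Pl H : H \in G -> \sum_(F : {ffun 'I_r -> {set edge n}} | [forall c, S c \subset F c]) kappa H F
    <= q2 ^+ s by move=> /kP[_ _].
(* For [s > 0] the factor 2 is absorbed by [(q / 2)^s <= q^s / 2]; for [s = 0] the claim is that a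
   probability is at most 1. *)
have [s0|s0] := posnP s.
  rewrite s0 expr0 mul1r; apply: ler_sum => H HG; rewrite ler_piMr //.
  by apply: le_trans (Pl H HG) _; rewrite s0.
apply: (@le_trans _ _ (q2 ^+ s * q1 ^+ s)); last first.
  rewrite -exprMn; apply: (@le_trans _ _ ((q / 2) ^+ s)).
    by apply: lerXn2r; rewrite ?nnegrE ?mulr_ge0 //; lra.
  rewrite expr_div_n; apply: ler_wpM2l; first exact: exprn_ge0.
  apply: (@le_trans _ _ 2^-1); last lra.
  by rewrite lef_pV2 ?posrE ?exprn_gt0 // ler_eXnr // ler1n.
have [cU|cU] := boolP (#|\bigcup_c S c| == s); last first.
  rewrite big1 ?mulr_ge0 ?exprn_ge0 // => H HG.
  by rewrite (spread_factorisation_supp (kP H HG)) ?mulr0 // (negPf cU) andbF.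
apply: (@le_trans _ _ (\sum_(H : {set edge n} | \bigcup_c S c \subset H) q2 ^+ s * mu H)); last first.
  rewrite -big_distrr /=; apply: ler_wpM2l; first exact: exprn_ge0.
  by rewrite -(eqP cU); exact: sp.
rewrite big_mkcond [leRHS]big_mkcond; apply: ler_sum => H _.
case: ifP => [HG|_]; last by case: ifP => // _; rewrite mulr_ge0 ?exprn_ge0.
case: ifP => [UH|UH].
  by rewrite mulrC; apply: ler_wpM2r => //; exact: Pl.
by rewrite (spread_factorisation_supp (kP H HG)) ?mulr0 // UH.
Qed.

(** * Choice of the constants *)

Theorem theorem3p1 (R : realType) :
  exists delta0 : R, 0 < delta0 /\
  forall delta : R, 0 < delta -> delta < delta0 ->
  exists C0 : R, forall C : R, C0 <= C ->
  exists delta'0 : R, 0 < delta'0 /\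
  forall delta' : R, 0 < delta' -> delta' < delta'0 ->
  exists K0 : R, forall K : R, K0 <= K ->
  forall (n r : nat), (1 <= r)%N -> (r <= n)%N ->
  forall mu : {set edge n} -> R,
    is_distr mu ->
    (forall H, 0 < mu H ->
       regular_bip r H /\ dense_bip delta delta' (r%:R / n%:R) H) ->
    spread mu (C * r%:R / n%:R) ->
  exists (G : {set {set edge n}})
         (kappa : {set edge n} -> {ffun 'I_r -> {set edge n}} -> R),
    1 - (n%:R ^+ 8)^-1 < \sum_(H in G) mu H /\
    (forall H, H \in G ->
       is_distr (kappa H) /\
       (forall F, 0 < kappa H F -> one_factorisation H F)) /\
    forall S : {ffun 'I_r -> {set edge n}},
      (\sum_(H in G) mu H *
         \sum_(F : {ffun 'I_r -> {set edge n}} | [forall c, S c \subset F c])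
            kappa H F) / (\sum_(H in G) mu H)
      <= (K / n%:R) ^+ (\sum_(c < r) #|S c|).
Proof.
exists 2^-1; split; first by rewrite invr_gt0.
move=> delta _ /ltW delta_le.
exists 1 => C C1.
have C0 : 0 < C by lra.
have cC : 0 < 18 * expR 1 ^+ 2 * C ^+ 2 :> R by rewrite !mulr_gt0 ?exprn_gt0 ?expR_gt0.
(* Pairs in the union bound have size at most [2 delta' n], so [18 = 2 * 9] provides the smallness
   that [term_le] asks for. *)
exists (18 * expR 1 ^+ 2 * C ^+ 2)^-1; split; first by rewrite invr_gt0.
move=> delta' _ /ltW; rewrite -[_^-1]mul1r ler_pdivlMr // mulrC => delta'_le.
(* With [k0 >= 11], degrees [r >= 2^k0] satisfy [52 <= r] and [1024 < r <= n]. *)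
have [k0 [k0_ge large]] : exists k0, (11 <= k0)%N /\ forall k, (k0 <= k)%N -> large_level k.
  by exists 64%N; split => // k; exact: large_level_eventually.
(* The 2 pays for conditioning, [2^(k0+2)] bounds [level_spread], and [C] comes from the spread of
   [mu]. *)
exists (2 * (2 ^+ (k0 + 2) * C)) => K KC n r r1 rn mu mud mus musp.
have [mu0 mu1] := mud.
have n1 : 1 <= n%:R :> R by rewrite ler1n; exact: leq_trans rn.
have n0 : 0 < n%:R :> R by lra.
have r0 : 0 < r%:R :> R by rewrite ltr0n.
have q0 : 0 <= C * r%:R / n%:R.
  exact: divr_ge0 (mulr_ge0 (le_trans ler01 C1) (ler0n _ _)) (ler0n _ _).
(* In bounded degree any 1-factorisation will do, with [q2 = 1], and the regular graphs form an
   event of probability 1. *)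
have [rk|rk] := ltnP r (2 ^ k0).
  pose G := [set H : {set edge n} | `[< regular_bip r H >]].
  have G1 : \sum_(H in G) mu H = 1.
    rewrite -mu1 big_mkcond; apply: eq_bigr => H _; case: ifPn => //.
    rewrite inE => /asboolPn nreg; apply/eqP; rewrite eq_le mu0 /=.
    by rewrite leNgt; apply/negP => /mus[].
  have [|||||||kappa [kP kS]] := @conditional_spread R n r mu G (C * r%:R / n%:R) 1 (K / n%:R) => //.
  - by rewrite G1; lra.
  - rewrite mul1r mulrA; apply: ler_wpM2r; first by rewrite invr_ge0 ltW.
    apply: le_trans KC; rewrite ler_pM2l // mulrC; apply: ler_wpM2r; first exact: ltW.
    by rewrite -natrX ler_nat (leq_trans (ltnW rk)) // leq_exp2l // leq_addr.
  - by move=> H; rewrite inE => /asboolP reg; exact: spread_factorisation_ge1.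
  exists G, kappa; split => //.
  by rewrite G1 gtrBl invr_gt0 exprn_gt0.
have r2048 : (2 ^ 11 <= r)%N by apply: leq_trans rk; rewrite leq_exp2l.
have r_ge : (52 <= r)%N by apply: leq_trans r2048.
have n_ge : (1024 < n)%N by apply: leq_trans (leq_trans r2048 rn).
have prob := random_expanding mud mus musp C1 delta_le delta'_le r_ge n_ge.
set G := [set H | _] in prob.
have p0 : 1 <= 2 * \sum_(H in G) mu H.
  have : (n%:R ^+ 8)^-1 <= 2^-1 :> R.
    rewrite lef_pV2 ?posrE ?exprn_gt0 //.
    apply: le_trans (_ : n%:R <= _); last by rewrite ler_eXnr.
    by rewrite ler_nat; apply: leq_trans n_ge.
  lra.
pose k := trunc_log 2 r.
have /andP[kr1 kr2] : (2 ^ k <= r < 2 ^ k.+1)%N by apply: trunc_log_bounds.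
have k0k : (k0 <= k)%N by rewrite -ltnS -(ltn_exp2l _ _ (ltnSn 1)); exact: leq_ltn_trans kr2.
have L0 : 0 <= level_spread R k0 k by rewrite mulr_ge0 ?exprn_ge0 ?divr_ge0.
have [|||||||kappa [kP kS]] := @conditional_spread R n r mu G (C * r%:R / n%:R)
  (level_spread R k0 k / r%:R) (K / n%:R) => //.
- by rewrite divr_ge0.
- rewrite (_ : 2 * _ = 2 * (level_spread R k0 k * C) / n%:R); last first.
    by field; rewrite !gt_eqF.
  apply: ler_wpM2r; first by rewrite invr_ge0 ltW.
  apply: le_trans KC; rewrite ler_pM2l // ler_pM2r //.
  rewrite /level_spread ler_piMr ?exprn_ge0 //.
  by rewrite ler_pdivrMr ?ltr0n // mul1r ler_nat.
- move=> H; rewrite inE => /asboolP[reg expd].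
  apply: spread_factorisation_ex => //.
  + by apply: leq_trans k0_ge.
  + by rewrite kr1 ltnW.
  + move=> T Tn; apply: (le_trans _ (expd T Tn)).
    apply: ler_wpM2r => //; apply: ler_wpM2r => //.
    rewrite /level_expansion ler_piMl ?invr_ge0 //.
    by rewrite ler_pdivrMr ?ltr0n // mul1r ler_nat.
by exists G, kappa.
Qed.
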